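(* Let $U$ and $B$ be $C^\infty$, fix $s\ge1$ and $q_0,p_0\in\mathbb{R}^m$, and let $(q(t),p(t))$ be the exact solution of $\dot q=p$, $\dot p=B(q)p-\nabla U(q)$, $q(0)=q_0$, $p(0)=p_0$. Suppose that for all sufficiently small $h>0$ there are polynomials $u=u_h$, $v=v_h$ of degree at most $s$ satisfying, for all $c\in[0,1]$, $$u(ch)=q_0+h\sum_{i=0}^{s-1}\Big(\int_0^cP_i(x)\,\mathrm{d}x\Big)\gamma_i(v),\qquad v(ch)=p_0+h\sum_{i=0}^{s-1}\Big(\int_0^cP_i(x)\,\mathrm{d}x\Big)\Big[-\eta_i(u)+\sum_{j=0}^{s-1}\rho_{ij}(u)\gamma_j(v)\Big],$$ with $(c,h)\mapsto u_h(ch), v_h(ch)$ smooth. Set $q_1=u(h)$, $p_1=v(h)$. Then, as $h\to0^+$, $$q_1=q(h)+O(h^{2s+1}),\qquad p_1=p(h)+O(h^{2s+1}),$$ i.e. the procedure has order $2s$.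
   Context: $U:\mathbb{R}^m\to\mathbb{R}$, $B:\mathbb{R}^m\to\mathbb{R}^{m\times m}$ with $B(q)^\top=-B(q)$ for all $q$. $\{P_j\}_{j\ge0}$ is the orthonormal Legendre basis on $[0,1]$ ($\deg P_j=j$, $\int_0^1P_iP_j=\delta_{ij}$), and for a path $\sigma:[0,h]\to\mathbb{R}^m$: $\gamma_j(\sigma)=\int_0^1P_j(\tau)\sigma(\tau h)\mathrm{d}\tau$, $\eta_j(\sigma)=\int_0^1P_j(\tau)\nabla U(\sigma(\tau h))\mathrm{d}\tau$, $\rho_{ij}(\sigma)=\int_0^1P_i(\tau)P_j(\tau)B(\sigma(\tau h))\mathrm{d}\tau$.
   Formalization: Smoothness of (c,h)↦u_h(ch), v_h(ch) is required up to h=0 (a smooth extension to R²); with smoothness only for h>0 the claim fails: m=s=1, B=0, U=−q⁴/4, q_0=p_0=0 admits u_h(ch)=c√8/h, v_h(ch)=2c√8/h². *)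

(* Defs.v *)
From Stdlib Require Import Reals ClassicalEpsilon.
From Stdlib Require Vectors.Fin.
Open Scope R_scope.

Definition Vec (n : nat) := Fin.t n -> R.

Fixpoint fsum (n : nat) : (Fin.t n -> R) -> R :=
  match n return (Fin.t n -> R) -> R with
  | O => fun _ => 0
  | S k => fun f => f Fin.F1 + fsum k (fun i => f (Fin.FS i))
  end.

Fixpoint nsum (n : nat) (f : nat -> R) : R :=
  match n with
  | O => 0
  | S k => nsum k f + f k
  end.

Definition shift {n : nat} (x : Vec n) (i : Fin.t n) (t : R) : Vec n :=
  fun j => if Fin.eq_dec i j then x j + t else x j.

Definition cont {n : nat} (f : Vec n -> R) : Prop :=
  forall x eps, 0 < eps -> exists d, 0 < d /\
    forall y, (forall i, Rabs (y i - x i) < d) -> Rabs (f y - f x) < eps.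

Definition is_partial {n : nat} (f : Vec n -> R) (i : Fin.t n) (g : Vec n -> R) : Prop :=
  forall x, derivable_pt_lim (fun t => f (shift x i t)) 0 (g x).

Fixpoint Ck (n k : nat) (f : Vec n -> R) : Prop :=
  match k with
  | O => cont f
  | S k' => cont f /\ forall i, exists g, is_partial f i g /\ Ck n k' g
  end.

Definition smooth {n : nat} (f : Vec n -> R) : Prop := forall k, Ck n k f.

Definition pair2 (c h : R) : Vec 2 :=
  fun i => match i with Fin.F1 => c | _ => h end.

(* Total version of the Riemann integral (equals RiemannInt when f is
   Riemann integrable on [a,b]; all integrands used here are continuous). *)
Definition integ (f : R -> R) (a b : R) : R :=
  epsilon (inhabits 0) (fun I => exists pr : Riemann_integrable f a b, RiemannInt pr = I).

(* Orthonormal shifted Legendre polynomials on [0,1]: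
   P_j(x) = sqrt(2j+1) * sum_{k=0}^j (-1)^(j+k) C(j,k) C(j+k,k) x^k. *)
Definition P (j : nat) (x : R) : R :=
  sqrt (INR (2 * j + 1)) *
  sum_f_R0 (fun k => (-1) ^ (j + k) * C j k * C (j + k) k * x ^ k) j.

Definition gamma {m : nat} (h : R) (sigma : R -> Vec m) (j : nat) : Vec m :=
  fun k => integ (fun tau => P j tau * sigma (tau * h) k) 0 1.

Definition eta {m : nat} (gradU : Vec m -> Vec m) (h : R) (sigma : R -> Vec m)
  (j : nat) : Vec m :=
  fun k => integ (fun tau => P j tau * gradU (sigma (tau * h)) k) 0 1.

Definition rho {m : nat} (B : Vec m -> Fin.t m -> Fin.t m -> R) (h : R)
  (sigma : R -> Vec m) (i j : nat) : Fin.t m -> Fin.t m -> R :=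
  fun k l => integ (fun tau => P i tau * P j tau * B (sigma (tau * h)) k l) 0 1.

(* Main.v *)
(* In the rescaled time c = t/h, the method reads
   u' = h Pi v, v' = h Pi g with g = B(u) Pi v - grad U(u), where Pi is the orthogonal projection
   onto polynomials of degree < s. Functions whose expansion in c has coefficient O(h^i) at c^i
   form an algebra that is stable under smooth maps and gains one order by integrating h times
   them; starting from mere boundedness, u, v and g therefore belong to it to all orders, so the
   defects Pi v - v and Pi g - g are O(h^s), and O(h^(2s)) when integrated against a weight in
   the algebra, because they are orthogonal to polynomials of degree < s.
   The error e = (u, v) - (q, p) is O(h^s) by iterating the mean value theorem and solves, up to
   O(h^(2s)), a linear equation e' = h (A e + defect). To reach 2s + 1 one integrates by parts
   against the tail primitive of a weight: this moves a factor O(h) onto the weight, so that after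
   s steps the integral of w e is O(h^(2s)); no differentiation of the flow with respect to its
   initial value is needed. *)

From Stdlib Require Import Reals Lra Lia FunctionalExtensionality ClassicalEpsilon.
From Coquelicot Require Import Coquelicot.
Require Import Defs.
From Stdlib Require Vectors.Fin.
Open Scope R_scope.

(** * Finite sums and integrals *)

(** The linearisation is made at the numerical solution and not at the exact one. Membership in the
    algebra is proved for [u] and [v], so the coefficients of the linear equation may be absorbed
    into a weight, whereas for [q] and [p] a bound near time 0 and their differential equation
    suffice. The quadratic remainder is harmless because the a priori bound O(h^s) on the error
    squares to O(h^(2s)). The algebra is defined by approximation up to O(h^n), not by derivatives:
    the coefficients are arbitrary functions of h with a size bound, so nothing is ever
    differentiated in h, and the joint regularity in c and h enters as a bound on [v] for small h.
    The projection preserves the algebra because a monomial c^i is either fixed or sent to lower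
    degree, where the bound O(h^i) on its coefficient is more than enough. Orthonormality of the
    explicit [P] is read off from the moments of the Legendre polynomials, which satisfy a
    first-order recurrence in the degree; neither Rodrigues' formula nor repeated integration by
    parts enters. *)

Lemma nsum_ext n f g : (forall i, (i < n)%nat -> f i = g i) -> nsum n f = nsum n g.
Proof.
  induction n as [|n IH]; intros H; simpl; [easy|].
  rewrite IH by (intros; apply H; lia). rewrite H by lia. easy.
Qed.

Lemma nsum_plus n f g : nsum n (fun i => f i + g i) = nsum n f + nsum n g.
Proof. induction n as [|n IH]; simpl; [ring|rewrite IH; ring]. Qed.

Lemma nsum_scal n a f : nsum n (fun i => a * f i) = a * nsum n f.
Proof. induction n as [|n IH]; simpl; [ring|rewrite IH; ring]. Qed.

Lemma nsum_zero n f : (forall i, (i < n)%nat -> f i = 0) -> nsum n f = 0.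
Proof.
  induction n as [|n IH]; intros H; simpl; [easy|].
  rewrite IH by (intros; apply H; lia). rewrite H by lia. ring.
Qed.

Lemma nsum_single n k f : (k < n)%nat ->
  (forall i, (i < n)%nat -> i <> k -> f i = 0) -> nsum n f = f k.
Proof.
  induction n as [|n IH]; intros Hk H; [lia|]. simpl.
  destruct (Nat.eq_dec k n) as [->|].
  - rewrite nsum_zero; [ring|]. intros; apply H; lia.
  - rewrite IH, (H n) by (try lia; intros; apply H; lia). ring.
Qed.

Lemma sum_f_R0_nsum f n : sum_f_R0 f n = nsum (S n) f.
Proof. induction n as [|n IH]; simpl in *; [ring|now rewrite IH]. Qed.

Lemma fsum_ext n f g : (forall i, f i = g i) -> fsum n f = fsum n g.
Proof. intros H. f_equal. now apply functional_extensionality. Qed.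

Lemma fsum_plus n f g : fsum n (fun i => f i + g i) = fsum n f + fsum n g.
Proof. induction n as [|n IH]; simpl; [ring|rewrite IH; ring]. Qed.

Lemma fsum_scal n a f : fsum n (fun i => a * f i) = a * fsum n f.
Proof. induction n as [|n IH]; simpl; [ring|rewrite IH; ring]. Qed.

Lemma nsum_fsum_exchange n m f :
  nsum n (fun i => fsum m (fun j => f i j)) = fsum m (fun j => nsum n (fun i => f i j)).
Proof.
  induction m as [|m IH]; simpl.
  - now rewrite nsum_zero.
  - now rewrite nsum_plus, IH.
Qed.

Lemma ex_RInt_nsum n f a b :
  (forall i, (i < n)%nat -> ex_RInt (f i) a b) ->
  ex_RInt (fun x => nsum n (fun i => f i x)) a b /\
  RInt (fun x => nsum n (fun i => f i x)) a b = nsum n (fun i => RInt (f i) a b).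
Proof.
  induction n as [|n IH]; intros H; simpl.
  - split; [apply ex_RInt_const|]. rewrite RInt_const. apply Rmult_0_r.
  - destruct IH as [H1 H2]; [intros; apply H; lia|].
    split.
    + apply @ex_RInt_plus; [exact H1 | apply H; lia].
    + rewrite <- H2. apply @RInt_plus; [exact H1 | apply H; lia].
Qed.

Lemma ex_RInt_fsum n f a b :
  (forall i, ex_RInt (f i) a b) ->
  ex_RInt (fun x => fsum n (fun i => f i x)) a b /\
  RInt (fun x => fsum n (fun i => f i x)) a b = fsum n (fun i => RInt (f i) a b).
Proof.
  induction n as [|n IH]; intros H; simpl.
  - split; [apply ex_RInt_const|]. rewrite RInt_const. apply Rmult_0_r.
  - destruct (IH (fun i => f (Fin.FS i))) as [H1 H2]; [intros; apply H|].
    split.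
    + apply @ex_RInt_plus; [apply H | exact H1].
    + rewrite <- H2. apply @RInt_plus; [apply H | exact H1].
Qed.

Lemma RInt_scal_R f a b k : ex_RInt f a b ->
  RInt (fun x => k * f x) a b = k * RInt f a b.
Proof. intros H. apply (RInt_scal f a b k H). Qed.

Lemma ex_RInt_scal_R f a b k : ex_RInt f a b -> ex_RInt (fun x => k * f x) a b.
Proof. intros H. apply (ex_RInt_scal f a b k H). Qed.

Lemma RInt_ext01 (f g : R -> R) :
  (forall x, 0 <= x <= 1 -> f x = g x) -> RInt f 0 1 = RInt g 0 1.
Proof.
  intros H. apply @RInt_ext. intros x. rewrite Rmin_left, Rmax_right by lra.
  intros Hx. apply H. lra.
Qed.

Lemma integ_RInt f a b : ex_RInt f a b -> integ f a b = RInt f a b.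
Proof.
  intros H. unfold integ.
  destruct (ClassicalEpsilon.epsilon_spec (inhabits 0)
    (fun I => exists pr : Riemann_integrable f a b, RiemannInt pr = I)) as [pr Hpr].
  { now exists (RiemannInt (ex_RInt_Reals_0 f a b H)), (ex_RInt_Reals_0 f a b H). }
  rewrite <- Hpr. symmetry. apply RInt_Reals.
Qed.

(** * Legendre polynomials *)

(* Normalised to take the value 1 at 1. Unlike the formula with binomials, this vanishes for
   [l > j] ([Binomial.C j l] is a nonzero junk value there). *)
Fixpoint legendre_coef (j l : nat) : R :=
  match l with
  | O => (-1) ^ j
  | S l' => - legendre_coef j l' * (INR j - INR l') * (INR j + INR l' + 1) / (INR l' + 1) ^ 2
  end.

Lemma legendre_coef_binomial j l : (l <= j)%nat ->
  legendre_coef j l = (-1) ^ (j + l) * Binomial.C j l * Binomial.C (j + l) l.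
Proof.
  induction l as [|l IH]; intros Hl.
  - rewrite Nat.add_0_r. simpl. unfold Binomial.C. rewrite !Nat.sub_0_r. simpl.
    field. apply INR_fact_neq_0.
  - simpl legendre_coef. rewrite IH by lia.
    rewrite Nat.add_succ_r. unfold Binomial.C.
    replace (j - l)%nat with (S (j - S l)) by lia.
    replace (j + l - l)%nat with j by lia.
    replace (S (j + l) - S l)%nat with j by lia.
    rewrite !fact_simpl, !mult_INR, !S_INR, plus_INR, minus_INR, !S_INR by lia.
    simpl pow.
    assert (0 <= INR l) by apply pos_INR.
    assert (INR l + 1 <= INR j) by (rewrite <- S_INR; now apply le_INR).
    assert (H1 := INR_fact_neq_0 l). assert (H2 := INR_fact_neq_0 j).
    assert (H3 := INR_fact_neq_0 (j - S l)).
    field. repeat split; try lra; easy.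
Qed.

Lemma legendre_coef_gt j l : (j < l)%nat -> legendre_coef j l = 0.
Proof.
  induction l as [|l IH]; intros Hl; [lia|]. simpl.
  destruct (Nat.eq_dec j l) as [->|]; [|rewrite IH by lia]; unfold Rdiv; ring.
Qed.

(** Raising both indices together leaves the factorial of [j - l] unchanged, so the ratio is
    polynomial and valid for all [j] and [l]. *)
Lemma legendre_coef_SS j l :
  legendre_coef (S j) (S l) * (INR l + 1) ^ 2 =
  (INR j + INR l + 2) * (INR j + INR l + 1) * legendre_coef j l.
Proof.
  induction l as [|l IH].
  - cbn [legendre_coef]. rewrite S_INR. change (INR 0) with 0. rewrite <- tech_pow_Rmult. field.
  - assert (0 <= INR l) by apply pos_INR.
    cbn [legendre_coef] in *. rewrite !S_INR in *.
    set (a := legendre_coef j l) in *. set (b := legendre_coef (S j) l) in *.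
    set (x := INR l) in *. set (y := INR j) in *.
    replace (- b * (y + 1 - x) * (y + 1 + x + 1) / (x + 1) ^ 2)
      with ((y + x + 2) * (y + x + 1) * a / (x + 1) ^ 2).
    + field. lra.
    + rewrite <- IH. field. lra.
Qed.

(** At [n = S j] this is the integral over [0,1] of y^x times the Legendre polynomial of degree [j]
    with value 1 at 1. The free cutoff [n] is what makes the telescoping below an induction. *)
Definition legendre_moment (j n : nat) (x : R) : R :=
  nsum n (fun l => legendre_coef j l / (x + INR l + 1)).

(* Zeilberger-style telescoping certificate for the hypergeometric moments. *)
Lemma legendre_moment_telescope j n x : 0 <= x ->
  (x + INR j + 2) * legendre_moment (S j) (S n) x - (x - INR j) * legendre_moment j (S n) x =
  - (2 / (INR j + 1)) * (INR j + INR n + 1) * legendre_coef j n.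
Proof.
  intros Hx. assert (Hj : 0 <= INR j) by apply pos_INR.
  unfold legendre_moment. induction n as [|n IH].
  - simpl. field. lra.
  - assert (Hn : 0 <= INR n) by apply pos_INR.
    cbn [nsum] in *.
    assert (E := legendre_coef_SS j n).
    assert (E' : legendre_coef (S j) (S n) =
      (INR j + INR n + 2) * (INR j + INR n + 1) * legendre_coef j n / (INR n + 1) ^ 2).
    { rewrite <- E. field. lra. }
    rewrite E'.
    match type of IH with ?k * ?a - ?k' * ?b = ?r =>
      match goal with |- k * (a + ?t) - k' * (b + ?t') = _ =>
        replace (k * (a + t) - k' * (b + t')) with (r + (k * t - k' * t'))
          by (rewrite <- IH; ring) end end.
    simpl legendre_coef. rewrite S_INR. field. repeat split; lra.
Qed.

(** At the cutoff [S j] the right-hand side of the telescoped identity contains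
    [legendre_coef j (S j) = 0], which leaves a two-term recurrence in the degree. *)
Lemma legendre_moment_S j x : 0 <= x ->
  (x + INR j + 2) * legendre_moment (S j) (S (S j)) x =
  (x - INR j) * legendre_moment j (S j) x.
Proof.
  intros Hx. assert (E := legendre_moment_telescope j (S j) x Hx).
  rewrite legendre_coef_gt in E by lia.
  assert (E2 : legendre_moment j (S (S j)) x = legendre_moment j (S j) x).
  { unfold legendre_moment at 1. cbn [nsum]. rewrite (legendre_coef_gt j (S j)) by lia.
    unfold legendre_moment. cbn [nsum]. unfold Rdiv. ring. }
  rewrite E2 in E. lra.
Qed.

(** Orthogonality to lower powers: the factor [x - INR j] of the recurrence vanishes when [j] passes
    [k], and the moment stays zero from then on. *)
Lemma legendre_moment_lt j k : (k < j)%nat -> legendre_moment j (S j) (INR k) = 0.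
Proof.
  induction j as [|j IH]; intros Hk; [lia|].
  assert (E := legendre_moment_S j (INR k) (pos_INR k)).
  assert (0 <= INR k) by apply pos_INR. assert (0 <= INR j) by apply pos_INR.
  assert (E2 : (INR k - INR j) * legendre_moment j (S j) (INR k) = 0).
  { destruct (Nat.eq_dec k j) as [->|]; [ring|]. rewrite IH by lia. ring. }
  rewrite E2 in E. apply Rmult_integral in E. destruct E; [lra|easy].
Qed.

(** The moment is the product of [x - i] over i < j divided by the product of [x + i + 1] over i <=
    j; this is the resulting ratio for a unit step in [x]. It serves the norm, where degree and
    exponent grow together. *)
Lemma legendre_moment_shift j x : 0 <= x ->
  (x + 1 - INR j) * (x + 2 + INR j) * legendre_moment j (S j) (x + 1) =
  (x + 1) ^ 2 * legendre_moment j (S j) x.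
Proof.
  intros Hx. induction j as [|j IH].
  - unfold legendre_moment. simpl. field. lra.
  - assert (0 <= INR j) by apply pos_INR.
    assert (E1 := legendre_moment_S j x Hx).
    assert (E2 := legendre_moment_S j (x + 1) ltac:(lra)).
    rewrite S_INR.
    set (a := legendre_moment j (S j) x) in *.
    set (b := legendre_moment j (S j) (x + 1)) in *.
    set (c := legendre_moment (S j) (S (S j)) x) in *.
    set (d := legendre_moment (S j) (S (S j)) (x + 1)) in *.
    apply Rmult_eq_reg_l with (x + INR j + 2); [|lra].
    transitivity ((x - INR j) * (x + INR j + 2) * ((x + 1 + INR j + 2) * d)); [ring|].
    rewrite E2.
    transitivity ((x - INR j) * ((x + 1 - INR j) * (x + 2 + INR j) * b)); [ring|].
    rewrite IH.
    transitivity ((x + 1) ^ 2 * ((x - INR j) * a)); [ring|].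
    rewrite <- E1. ring.
Qed.

(** Since lower powers are orthogonal, leading coefficient times moment of order [j] is the squared
    norm before normalisation. The value 1 / (2j + 1) explains the factor [sqrt (INR (2 * j + 1))]
    in [P]. *)
Lemma legendre_norm j :
  (2 * INR j + 1) * legendre_coef j j * legendre_moment j (S j) (INR j) = 1.
Proof.
  induction j as [|j IH].
  - unfold legendre_moment. simpl. field.
  - assert (Hj : 0 <= INR j) by apply pos_INR.
    assert (E1 := legendre_coef_SS j j).
    assert (E2 := legendre_moment_S j (INR (S j)) (pos_INR _)).
    assert (E3 := legendre_moment_shift j (INR j) Hj).
    rewrite !S_INR in *.
    set (a := legendre_coef j j) in *. set (a' := legendre_coef (S j) (S j)) in *.
    set (b := legendre_moment j (S j) (INR j)) in *.
    set (b' := legendre_moment j (S j) (INR j + 1)) in *.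
    set (d := legendre_moment (S j) (S (S j)) (INR j + 1)) in *.
    set (x := INR j) in *.
    assert (Ha : a' = 2 * (2 * x + 1) * a / (x + 1)).
    { apply Rmult_eq_reg_r with ((x + 1) ^ 2); [|nra]. rewrite E1. field. lra. }
    assert (Hb : b' = (x + 1) * b / 2).
    { apply Rmult_eq_reg_l with (2 * x + 2); [|lra].
      transitivity ((x + 1 - x) * (x + 2 + x) * b'); [ring|]. rewrite E3. field. }
    assert (Hd : d = b' / (2 * x + 3)).
    { apply Rmult_eq_reg_l with (x + 1 + x + 2); [|lra]. rewrite E2. field. lra. }
    rewrite Ha, Hd, Hb. transitivity ((2 * x + 1) * a * b); [field; lra|easy].
Qed.

Lemma legendre_coef_diag_neq_0 j : legendre_coef j j <> 0.
Proof.
  intros H. assert (E := legendre_norm j). rewrite H in E. lra.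
Qed.

Lemma P_nsum j x :
  P j x = sqrt (INR (2 * j + 1)) * nsum (S j) (fun l => legendre_coef j l * x ^ l).
Proof.
  unfold P. rewrite sum_f_R0_nsum. f_equal. apply nsum_ext. intros l Hl.
  now rewrite legendre_coef_binomial by lia.
Qed.

Lemma is_derive_nsum n f df (x : R) :
  (forall i, (i < n)%nat -> is_derive (f i) x (df i)) ->
  is_derive (fun y => nsum n (fun i => f i y)) x (nsum n df).
Proof.
  induction n as [|n IH]; intros H; simpl.
  - apply @is_derive_const.
  - apply @is_derive_plus; [apply IH; intros; apply H; lia | apply H; lia].
Qed.

Lemma continuous_nsum n (f : nat -> R -> R) (x : R) :
  (forall i, (i < n)%nat -> continuous (f i) x) ->
  continuous (fun y => nsum n (fun i => f i y)) x.
Proof.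
  induction n as [|n IH]; intros H; simpl.
  - apply continuous_const.
  - apply @continuous_plus; [apply IH; intros; apply H; lia | apply H; lia].
Qed.

Lemma continuous_fsum n (f : Fin.t n -> R -> R) (x : R) :
  (forall i, continuous (f i) x) ->
  continuous (fun y => fsum n (fun i => f i y)) x.
Proof.
  induction n as [|n IH]; intros H; simpl.
  - apply continuous_const.
  - apply @continuous_plus; [apply H | apply (IH (fun i => f (Fin.FS i))); intros; apply H].
Qed.

Lemma continuous_Rmult (f g : R -> R) x :
  continuous f x -> continuous g x -> continuous (fun y => f y * g y) x.
Proof. intros; now apply (continuous_mult f g x). Qed.

Lemma continuous_pow_R n (x : R) : continuous (fun y : R => y ^ n) x.
Proof.
  apply @ex_derive_continuous. eexists. apply is_derive_pow, is_derive_id.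
Qed.

Lemma continuous_P j x : continuous (P j) x.
Proof.
  apply continuous_ext with (1 := fun y => eq_sym (P_nsum j y)).
  apply continuous_Rmult; [apply continuous_const|].
  apply continuous_nsum. intros. apply continuous_Rmult; [apply continuous_const|].
  apply continuous_pow_R.
Qed.

Lemma RInt_pow_01 k : RInt (fun x => x ^ k) 0 1 = / (INR k + 1) :> R.
Proof.
  assert (0 <= INR k) by apply pos_INR.
  apply is_RInt_unique.
  replace (/ (INR k + 1)) with (minus (1 ^ S k / (INR k + 1)) (0 ^ S k / (INR k + 1))).
  - apply (is_RInt_derive (fun x => x ^ S k / (INR k + 1))).
    + intros x _. auto_derive; [easy|].
      replace (match k with O => 1 | S _ => INR k + 1 end) with (INR k + 1)
        by (destruct k; simpl; ring).
      field. lra.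
    + intros. apply continuous_pow_R.
  - unfold minus, plus, opp; simpl. rewrite pow1. field. lra.
Qed.

Lemma ex_RInt_cont (f : R -> R) a b : (forall x, continuous f x) -> ex_RInt f a b.
Proof. intros H. apply @ex_RInt_continuous. intros; apply H. Qed.

Lemma RInt_nsum_pow n (a : nat -> R) (f : R -> R) : (forall x, continuous f x) ->
  RInt (fun x => nsum n (fun l => a l * x ^ l) * f x) 0 1 =
  nsum n (fun l => a l * RInt (fun x => x ^ l * f x) 0 1).
Proof.
  intros Hf.
  assert (Hc : forall l, ex_RInt (fun x => x ^ l * f x) 0 1).
  { intros l. apply ex_RInt_cont. intros. apply continuous_Rmult; [apply continuous_pow_R|easy]. }
  rewrite (nsum_ext n _ (fun l => RInt (fun x => a l * (x ^ l * f x)) 0 1)).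
  2:{ intros. now rewrite RInt_scal_R. }
  rewrite <- (proj2 (ex_RInt_nsum n (fun l x => a l * (x ^ l * f x)) 0 1
    (fun l _ => ex_RInt_scal_R _ _ _ (a l) (Hc l)))).
  apply RInt_ext01. intros x _.
  rewrite Rmult_comm, <- nsum_scal. apply nsum_ext. intros; ring.
Qed.

Lemma RInt_P_pow j k :
  RInt (fun x => P j x * x ^ k) 0 1 = sqrt (INR (2 * j + 1)) * legendre_moment j (S j) (INR k).
Proof.
  rewrite (RInt_ext01 _ (fun x => sqrt (INR (2 * j + 1)) *
     (nsum (S j) (fun l => legendre_coef j l * x ^ l) * x ^ k))).
  2:{ intros. rewrite P_nsum. ring. }
  rewrite RInt_scal_R.
  2:{ apply ex_RInt_cont. intros. apply continuous_Rmult; [|apply continuous_pow_R].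
    apply continuous_nsum. intros. apply continuous_Rmult; [apply continuous_const|].
    apply continuous_pow_R. }
  rewrite RInt_nsum_pow by apply continuous_pow_R. f_equal.
  apply nsum_ext. intros l _. unfold Rdiv. f_equal.
  rewrite (RInt_ext01 _ (fun x => x ^ (k + l))) by (intros; rewrite pow_add; ring).
  rewrite RInt_pow_01, plus_INR. easy.
Qed.

Lemma RInt_P_P_lt j k : (k < j)%nat -> RInt (fun x => P j x * P k x) 0 1 = 0 :> R.
Proof.
  intros Hk.
  rewrite (RInt_ext01 _ (fun x => sqrt (INR (2 * k + 1)) *
     (nsum (S k) (fun l => legendre_coef k l * x ^ l) * P j x))).
  2:{ intros. rewrite (P_nsum k). ring. }
  rewrite RInt_scal_R.
  2:{ apply ex_RInt_cont. intros. apply continuous_Rmult; [|apply continuous_P].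
    apply continuous_nsum. intros. apply continuous_Rmult; [apply continuous_const|].
    apply continuous_pow_R. }
  rewrite RInt_nsum_pow by apply continuous_P.
  rewrite nsum_zero; [ring|]. intros l Hl.
  rewrite (RInt_ext01 _ (fun x => P j x * x ^ l)) by (intros; ring).
  rewrite RInt_P_pow, legendre_moment_lt by lia. ring.
Qed.

Lemma RInt_P_P j k : RInt (fun x => P j x * P k x) 0 1 = (if Nat.eq_dec j k then 1 else 0) :> R.
Proof.
  destruct (Nat.eq_dec j k) as [->|Hjk].
  - rewrite (RInt_ext01 _ (fun x => sqrt (INR (2 * k + 1)) *
     (nsum (S k) (fun l => legendre_coef k l * x ^ l) * P k x))).
    2:{ intros. rewrite (P_nsum k) at 1. ring. }
    rewrite RInt_scal_R.
    2:{ apply ex_RInt_cont. intros. apply continuous_Rmult; [|apply continuous_P].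
      apply continuous_nsum. intros. apply continuous_Rmult; [apply continuous_const|].
      apply continuous_pow_R. }
    rewrite RInt_nsum_pow by apply continuous_P.
    assert (E : forall l, RInt (fun x => x ^ l * P k x) 0 1 =
       sqrt (INR (2 * k + 1)) * legendre_moment k (S k) (INR l)).
    { intros l. rewrite <- RInt_P_pow. apply RInt_ext01. intros; ring. }
    rewrite (nsum_single _ k); [|lia|].
    + rewrite E.
      transitivity ((sqrt (INR (2 * k + 1)) * sqrt (INR (2 * k + 1))) *
        legendre_coef k k * legendre_moment k (S k) (INR k)); [ring|].
      rewrite sqrt_def by apply pos_INR.
      rewrite <- (legendre_norm k), plus_INR, mult_INR. simpl. ring.
    + intros l Hl Hlk. rewrite E, legendre_moment_lt by lia. ring.
  - destruct (Nat.lt_total k j) as [H|[H|H]]; [now apply RInt_P_P_lt|lia|].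
    rewrite (RInt_ext01 _ (fun x => P k x * P j x)) by (intros; ring). now apply RInt_P_P_lt.
Qed.

(** * Orthogonal projection onto polynomials of degree below [s] *)

Definition legendre_proj (s : nat) (f : R -> R) (x : R) : R :=
  nsum s (fun j => P j x * RInt (fun y => P j y * f y) 0 1).

Lemma ex_RInt_P_mult j (f : R -> R) : (forall x, 0 <= x <= 1 -> continuous f x) ->
  ex_RInt (fun y => P j y * f y) 0 1.
Proof.
  intros H. apply @ex_RInt_continuous. intros x. rewrite Rmin_left, Rmax_right by lra.
  intros Hx. apply continuous_Rmult; [apply continuous_P | now apply H].
Qed.

Lemma legendre_proj_plus s (f g : R -> R) x :
  (forall x, 0 <= x <= 1 -> continuous f x) -> (forall x, 0 <= x <= 1 -> continuous g x) ->
  legendre_proj s (fun y => f y + g y) x = legendre_proj s f x + legendre_proj s g x.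
Proof.
  intros Hf Hg. unfold legendre_proj. rewrite <- nsum_plus. apply nsum_ext. intros j _.
  rewrite <- Rmult_plus_distr_l. f_equal.
  rewrite (RInt_ext01 _ (fun y => P j y * f y + P j y * g y)) by (intros; ring).
  apply (RInt_plus (fun y => P j y * f y) (fun y => P j y * g y)); now apply ex_RInt_P_mult.
Qed.

Lemma legendre_proj_scal s a (f : R -> R) x :
  (forall x, 0 <= x <= 1 -> continuous f x) ->
  legendre_proj s (fun y => a * f y) x = a * legendre_proj s f x.
Proof.
  intros Hf. unfold legendre_proj. rewrite <- nsum_scal. apply nsum_ext. intros j _.
  rewrite (RInt_ext01 _ (fun y => a * (P j y * f y))) by (intros; ring).
  rewrite RInt_scal_R by now apply ex_RInt_P_mult. ring.
Qed.

Lemma legendre_proj_nsum s n (f : nat -> R -> R) x :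
  (forall i x, (i < n)%nat -> continuous (f i) x) ->
  legendre_proj s (fun y => nsum n (fun i => f i y)) x = nsum n (fun i => legendre_proj s (f i) x).
Proof.
  induction n as [|n IH]; intros H; simpl.
  - unfold legendre_proj. apply nsum_zero. intros.
    rewrite (RInt_ext01 _ (fun _ => 0)) by (intros; ring).
    rewrite RInt_const. unfold scal; simpl; unfold mult; simpl. ring.
  - rewrite legendre_proj_plus, IH; [easy|..]; intros; try (apply continuous_nsum; intros); apply H; lia.
Qed.

Lemma legendre_proj_P s k x : (k < s)%nat -> legendre_proj s (P k) x = P k x.
Proof.
  intros Hk. unfold legendre_proj. rewrite (nsum_single _ k); [|easy|].
  - rewrite RInt_P_P. destruct (Nat.eq_dec k k); [ring|easy].
  - intros i _ Hik. rewrite RInt_P_P. destruct (Nat.eq_dec i k); [easy|ring].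
Qed.

(** The leading coefficient is nonzero, so a power is a multiple of [P k] plus lower powers, and
    strong induction applies. *)
Lemma legendre_proj_pow s k x : (k < s)%nat -> legendre_proj s (fun y => y ^ k) x = x ^ k.
Proof.
  revert x. induction k as [k IH] using (well_founded_induction Nat.lt_wf_0). intros x Hk.
  assert (Hl := legendre_coef_diag_neq_0 k).
  assert (Hs : sqrt (INR (2 * k + 1)) <> 0).
  { apply Rgt_not_eq, sqrt_lt_R0. apply lt_0_INR. lia. }
  (* Coefficients obtained by solving [P_nsum] for its top power [y ^ k]. *)
  set (a := / (sqrt (INR (2 * k + 1)) * legendre_coef k k)).
  set (b := - / legendre_coef k k).
  assert (E : forall y, y ^ k = a * P k y + b * nsum k (fun l => legendre_coef k l * y ^ l)).
  { intros y. rewrite P_nsum. simpl nsum. unfold a, b. field. now split. }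
  assert (Hc : forall l x, continuous (fun y => legendre_coef k l * y ^ l) x).
  { intros. apply continuous_Rmult; [apply continuous_const|apply continuous_pow_R]. }
  assert (Hc2 : forall x, continuous (fun y => nsum k (fun l => legendre_coef k l * y ^ l)) x).
  { intros. apply continuous_nsum. intros; apply Hc. }
  transitivity (legendre_proj s (fun y => a * P k y + b * nsum k (fun l => legendre_coef k l * y ^ l)) x).
  { f_equal. now apply functional_extensionality. }
  rewrite legendre_proj_plus, !legendre_proj_scal, legendre_proj_P, legendre_proj_nsum; try easy.
  2: intros; apply continuous_P.
  2, 3: intros; apply continuous_Rmult; [apply continuous_const|]; first [easy | apply continuous_P].
  rewrite E. f_equal. f_equal. apply nsum_ext. intros l Hlt.
  rewrite legendre_proj_scal by (intros; apply continuous_pow_R).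
  rewrite IH by lia. easy.
Qed.

(** * Families indexed by the step size *)

Lemma near_lt d : 0 < d -> at_right 0 (fun h => 0 < h < d).
Proof.
  intros Hd. exists (mkposreal d Hd). intros y Hy H0. split; [easy|].
  unfold ball in Hy; simpl in Hy. unfold AbsRing_ball, abs, minus, plus, opp in Hy; simpl in Hy.
  apply Rabs_def2 in Hy. lra.
Qed.

Lemma near_all (A : R -> Prop) : (forall h, A h) -> at_right 0 A.
Proof. intros H. apply filter_imp with (2 := filter_true). now intros. Qed.

(** Hands out [0 < h < 1] in passing, the range in which powers of [h] decrease with the
    exponent. *)
Lemma near_imp (A B : R -> Prop) : at_right 0 A ->
  (forall h, 0 < h < 1 -> A h -> B h) -> at_right 0 B.
Proof.
  intros HA H.
  apply (filter_imp (fun h => 0 < h < 1 /\ A h)); [intros h [? ?]; now apply H|].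
  apply filter_and; [apply near_lt; lra|easy].
Qed.

Lemma near_imp2 (A B D : R -> Prop) : at_right 0 A -> at_right 0 B ->
  (forall h, 0 < h < 1 -> A h -> B h -> D h) -> at_right 0 D.
Proof.
  intros HA HB H.
  apply (near_imp (fun h => A h /\ B h)); [now apply filter_and|].
  intros h Hh [? ?]. now apply H.
Qed.

Lemma filter_forall_fin {T : Type} (F : (T -> Prop) -> Prop) {FF : Filter F} n
  (A : Fin.t n -> T -> Prop) : (forall i, F (A i)) -> F (fun x => forall i, A i x).
Proof.
  induction n as [|n IH]; intros H.
  - apply filter_imp with (2 := filter_true). intros x _ i. inversion i.
  - apply (filter_imp (fun x => A Fin.F1 x /\ forall i, A (Fin.FS i) x)).
    + intros x [H1 H2] i. revert A H H1 H2. pattern i. apply Fin.caseS'; intros; auto.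
    + apply filter_and; [apply H | apply (IH (fun i => A (Fin.FS i))); intros; apply H].
Qed.

(** Quantities that depend on [h] alone are families constant in [c], so one predicate covers both
    kinds. *)
Definition Ord (n : nat) (f : R -> R -> R) : Prop :=
  exists K, 0 < K /\ at_right 0 (fun h => forall c, 0 <= c <= 1 -> Rabs (f h c) <= K * h ^ n).

(** Regularity is asked on an open interval around [0,1], so that two-sided derivatives make sense
    at both ends; size bounds concern [0,1] only. *)
Definition eventually_continuous (f : R -> R -> R) : Prop :=
  at_right 0 (fun h => forall c, -1 < c < 2 -> continuous (f h) c).

(* In the rescaled time [c = t / h] a time derivative [w] becomes [h * w]. *)
Definition eventually_derive (f w : R -> R -> R) : Prop :=
  at_right 0 (fun h => forall c, -1 < c < 2 -> is_derive (f h) c (h * w h c)).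

Lemma pow_le_1 h n k : 0 < h < 1 -> (k <= n)%nat -> h ^ n <= h ^ k.
Proof.
  intros Hh Hk. replace n with (k + (n - k))%nat by lia. rewrite pow_add.
  rewrite <- (Rmult_1_r (h ^ k)) at 2. apply Rmult_le_compat_l.
  - apply pow_le. lra.
  - rewrite <- (pow1 (n - k)). apply pow_incr. lra.
Qed.

Lemma Ord_le n k f : (k <= n)%nat -> Ord n f -> Ord k f.
Proof.
  intros Hk [K [HK H]]. exists K. split; [easy|]. apply (near_imp _ _ H).
  intros h Hh Hf c Hc. apply Rle_trans with (1 := Hf c Hc).
  apply Rmult_le_compat_l; [lra|]. now apply pow_le_1.
Qed.

Lemma Ord_ext n f g :
  at_right 0 (fun h => forall c, 0 <= c <= 1 -> f h c = g h c) -> Ord n f -> Ord n g.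
Proof.
  intros E [K [HK H]]. exists K. split; [easy|]. apply (near_imp2 _ _ _ E H).
  intros h Hh He Hf c Hc. rewrite <- He by easy. now apply Hf.
Qed.

Lemma Ord_ext_all n f g : (forall h c, f h c = g h c) -> Ord n f -> Ord n g.
Proof.
  intros E. apply Ord_ext. apply near_all. now intros.
Qed.

Lemma Ord_plus n f g : Ord n f -> Ord n g -> Ord n (fun h c => f h c + g h c).
Proof.
  intros [K [HK Hf]] [M [HM Hg]]. exists (K + M). split; [lra|].
  apply (near_imp2 _ _ _ Hf Hg). intros h Hh H1 H2 c Hc.
  apply Rle_trans with (1 := Rabs_triang _ _). specialize (H1 c Hc). specialize (H2 c Hc). lra.
Qed.

Lemma Ord_mult n k f g : Ord n f -> Ord k g -> Ord (n + k) (fun h c => f h c * g h c).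
Proof.
  intros [K [HK Hf]] [M [HM Hg]]. exists (K * M). split; [nra|].
  apply (near_imp2 _ _ _ Hf Hg). intros h Hh H1 H2 c Hc.
  rewrite Rabs_mult, pow_add.
  replace (K * M * (h ^ n * h ^ k)) with ((K * h ^ n) * (M * h ^ k)) by ring.
  apply Rmult_le_compat; auto using Rabs_pos.
Qed.

Lemma Ord_const a : Ord 0 (fun _ _ => a).
Proof.
  exists (Rabs a + 1). split; [assert (H := Rabs_pos a); lra|].
  apply near_all. intros h c _. simpl.
  assert (H := Rabs_pos a). lra.
Qed.

Lemma Ord_zero n : Ord n (fun _ _ => 0).
Proof.
  exists 1. split; [lra|]. apply (near_imp _ _ (near_lt 1 Rlt_0_1)).
  intros h Hh _ c _. rewrite Rabs_R0. assert (0 < h ^ n) by (apply pow_lt; lra). lra.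
Qed.

Lemma Ord_scal n a f : Ord n f -> Ord n (fun h c => a * f h c).
Proof. intros H. apply (Ord_mult 0 n); [apply Ord_const|easy]. Qed.

Lemma Ord_opp n f : Ord n f -> Ord n (fun h c => - f h c).
Proof.
  intros H. apply Ord_ext_all with (fun h c => -1 * f h c); [intros; ring|]. now apply Ord_scal.
Qed.

Lemma Ord_minus n f g : Ord n f -> Ord n g -> Ord n (fun h c => f h c - g h c).
Proof. intros. apply Ord_plus; [easy|]. now apply Ord_opp. Qed.

Lemma Ord_step : Ord 1 (fun h _ => h).
Proof.
  exists 1. split; [lra|]. apply (near_imp _ _ (near_lt 1 Rlt_0_1)).
  intros h Hh _ c _. rewrite Rabs_pos_eq by lra. simpl. lra.
Qed.

Lemma Ord_step_mult n f : Ord n f -> Ord (S n) (fun h c => h * f h c).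
Proof. intros H. apply (Ord_mult 1 n); [apply Ord_step|easy]. Qed.

Lemma Ord_nsum n N f : (forall i, (i < N)%nat -> Ord n (f i)) ->
  Ord n (fun h c => nsum N (fun i => f i h c)).
Proof.
  induction N as [|N IH]; intros H; simpl; [apply Ord_zero|].
  apply Ord_plus; [apply IH; intros; apply H; lia | apply H; lia].
Qed.

Lemma Ord_fsum n m (f : Fin.t m -> R -> R -> R) : (forall i, Ord n (f i)) ->
  Ord n (fun h c => fsum m (fun i => f i h c)).
Proof.
  induction m as [|m IH]; intros H; simpl; [apply Ord_zero|].
  apply Ord_plus; [apply H | apply (IH (fun i => f (Fin.FS i))); intros; apply H].
Qed.

Lemma Ord_continuous (f : R -> R) : (forall x, continuous f x) -> Ord 0 (fun _ c => f c).
Proof.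
  intros H. destruct (continuity_ab_maj (fun x => Rabs (f x)) 0 1 Rle_0_1) as [x [Hx _]].
  - intros c _. apply continuity_pt_filterlim.
    apply (continuous_comp f Rabs); [apply H|]. apply continuous_Rabs.
  - exists (Rabs (f x) + 1). split; [assert (Hp := Rabs_pos (f x)); lra|].
    apply near_all. intros h c Hc. specialize (Hx c Hc). simpl. lra.
Qed.

Lemma Ord_fin n m (f : Fin.t m -> R -> R -> R) : (forall i, Ord n (f i)) ->
  exists K, 0 < K /\
  at_right 0 (fun h => forall i c, 0 <= c <= 1 -> Rabs (f i h c) <= K * h ^ n).
Proof.
  induction m as [|m IH]; intros H.
  - exists 1. split; [lra|]. apply near_all. intros h i. inversion i.
  - destruct (IH (fun i => f (Fin.FS i))) as [K [HK H1]]; [intros; apply H|].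
    destruct (H Fin.F1) as [M [HM H2]].
    exists (K + M). split; [lra|].
    apply (near_imp2 _ _ _ H1 H2). intros h Hh H3 H4 i c Hc.
    assert (Hp : 0 < h ^ n) by (apply pow_lt; lra).
    assert (HKp : 0 < K * h ^ n) by nra. assert (HMp : 0 < M * h ^ n) by nra.
    revert H3 H4. clear -HKp HMp Hc. rewrite Rmult_plus_distr_r. pattern i.
    apply Fin.caseS'; intros.
    + specialize (H4 c Hc). lra.
    + specialize (H3 p c Hc). lra.
Qed.

Lemma Rabs_fsum_le n f M : (forall i, Rabs (f i) <= M) -> Rabs (fsum n f) <= INR n * M.
Proof.
  induction n as [|n IH]; intros H.
  - simpl. rewrite Rabs_R0. lra.
  - rewrite S_INR. simpl fsum. apply Rle_trans with (1 := Rabs_triang _ _).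
    specialize (IH (fun i => f (Fin.FS i)) (fun i => H (Fin.FS i))).
    specialize (H Fin.F1). lra.
Qed.

Lemma RInt_01_bound (f : R -> R) M :
  (forall x, 0 <= x <= 1 -> continuous f x) -> (forall x, 0 <= x <= 1 -> Rabs (f x) <= M) ->
  Rabs (RInt f 0 1) <= M.
Proof.
  intros Hf HM. rewrite <- (Rmult_1_l M). replace 1 with (1 - 0) at 2 by ring.
  apply abs_RInt_le_const; [lra| |easy].
  apply @ex_RInt_continuous. intros x. rewrite Rmin_left, Rmax_right by lra. apply Hf.
Qed.

Lemma Ord_RInt n f : eventually_continuous f -> Ord n f -> Ord n (fun h _ => RInt (f h) 0 1).
Proof.
  intros Hc [K [HK Hf]]. exists K. split; [easy|].
  apply (near_imp2 _ _ _ Hc Hf). intros h Hh H1 H2 c _.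
  apply RInt_01_bound; intros x Hx; [apply H1; lra | now apply H2].
Qed.

Lemma eventually_continuous_const a : eventually_continuous (fun h _ => a h).
Proof.
  apply near_all. intros h c _. apply continuous_const.
Qed.

Lemma eventually_continuous_plus f g : eventually_continuous f -> eventually_continuous g ->
  eventually_continuous (fun h c => f h c + g h c).
Proof.
  intros Hf Hg. apply (near_imp2 _ _ _ Hf Hg). intros h _ H1 H2 c Hc.
  apply (continuous_plus (f h) (g h)); auto.
Qed.

Lemma eventually_continuous_mult f g : eventually_continuous f -> eventually_continuous g ->
  eventually_continuous (fun h c => f h c * g h c).
Proof.
  intros Hf Hg. apply (near_imp2 _ _ _ Hf Hg). intros h _ H1 H2 c Hc.
  apply (continuous_Rmult (f h) (g h)); auto.
Qed.

Lemma eventually_continuous_opp f : eventually_continuous f ->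
  eventually_continuous (fun h c => - f h c).
Proof.
  intros Hf. apply (near_imp _ _ Hf). intros h _ H1 c Hc.
  apply (continuous_opp (f h)); auto.
Qed.

Lemma eventually_continuous_minus f g : eventually_continuous f -> eventually_continuous g ->
  eventually_continuous (fun h c => f h c - g h c).
Proof.
  intros. apply eventually_continuous_plus; [easy|]. now apply eventually_continuous_opp.
Qed.

Lemma eventually_continuous_fsum m (f : Fin.t m -> R -> R -> R) :
  (forall i, eventually_continuous (f i)) ->
  eventually_continuous (fun h c => fsum m (fun i => f i h c)).
Proof.
  intros H. apply (near_imp _ _ (filter_forall_fin _ _ _ H)). intros h _ H1 c Hc.
  apply continuous_fsum. intros i. now apply H1.
Qed.

Lemma eventually_continuous_derive f w : eventually_derive f w -> eventually_continuous f.
Proof.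
  intros H. apply (near_imp _ _ H). intros h _ H1 c Hc.
  apply @ex_derive_continuous. eexists. now apply H1.
Qed.

(** Mean value theorem from 0 to [c]: the factor [h] of the rescaled derivative is the gain of one
    order. *)
Lemma Ord_derive n k f w : eventually_derive f w -> Ord n (fun h _ => f h 0) -> Ord k w ->
  (n <= S k)%nat -> Ord n f.
Proof.
  intros Hd H0 Hw Hn. apply (Ord_step_mult k), (Ord_le _ n) in Hw; [|easy].
  destruct H0 as [K [HK H0]]. destruct Hw as [M [HM Hw]].
  exists (K + M). split; [lra|].
  apply (near_imp2 _ _ _ Hd (filter_and _ _ H0 Hw)). clear. intros h Hh Hd [H0 Hw] c Hc.
  destruct (MVT_gen (f h) 0 c (fun c => h * w h c)) as [x [Hx Hm]].
  - intros x. rewrite Rmin_left, Rmax_right by lra. intros. apply Hd; lra.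
  - intros x. rewrite Rmin_left, Rmax_right by lra. intros. apply continuity_pt_filterlim.
    apply @ex_derive_continuous. eexists. apply Hd; lra.
  - rewrite Rmin_left, Rmax_right in Hx by lra.
    replace (f h c) with (f h 0 + (f h c - f h 0)) by ring. rewrite Hm.
    apply Rle_trans with (1 := Rabs_triang _ _). rewrite Rmult_plus_distr_r.
    apply Rplus_le_compat; [now apply (H0 0); lra|].
    rewrite Rabs_mult, Rminus_0_r, (Rabs_pos_eq c) by lra.
    assert (Hy := Hw x ltac:(lra)). assert (Hz := Rabs_pos (h * w h x)).
    apply Rle_trans with (2 := Hy). nra.
Qed.

(* Polynomials in the physical time [h * c] with bounded coefficients. *)
Inductive Pol : (R -> R -> R) -> Prop :=
| Pol_mono i a : Ord i (fun h _ => a h) -> Pol (fun h c => a h * c ^ i)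
| Pol_add f g : Pol f -> Pol g -> Pol (fun h c => f h c + g h c).

(** Stands in for a Taylor expansion of length [n]; the remainder is only small and carries no
    regularity. *)
Definition App (n : nat) (f : R -> R -> R) : Prop :=
  exists g, Pol g /\ Ord n (fun h c => f h c - g h c).

Lemma Pol_ext f g : (forall h c, f h c = g h c) -> Pol f -> Pol g.
Proof.
  intros E. replace g with f; [easy|].
  apply functional_extensionality; intros h. now apply functional_extensionality.
Qed.

Lemma Pol_const a : Ord 0 (fun h _ => a h) -> Pol (fun h _ => a h).
Proof.
  intros H. apply Pol_ext with (fun h c => a h * c ^ 0); [intros; simpl; ring|].
  now apply Pol_mono.
Qed.

Lemma Ord_mono n i a : Ord n (fun h _ => a h) -> Ord n (fun h c => a h * c ^ i).
Proof.
  intros H. rewrite <- (Nat.add_0_r n). apply Ord_mult; [easy|].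
  apply Ord_continuous. intros. apply continuous_pow_R.
Qed.

Lemma Pol_Ord f : Pol f -> Ord 0 f.
Proof.
  induction 1 as [i a Ha|f g _ IHf _ IHg]; [|now apply Ord_plus].
  apply Ord_mono. apply Ord_le with i; [lia|easy].
Qed.

Lemma Pol_continuous f : Pol f -> forall h c, continuous (f h) c.
Proof.
  induction 1 as [i a Ha|f g _ IHf _ IHg]; intros h c.
  - apply continuous_Rmult; [apply continuous_const|apply continuous_pow_R].
  - now apply (continuous_plus (f h) (g h)).
Qed.

Lemma Pol_eventually_continuous f : Pol f -> eventually_continuous f.
Proof.
  intros H. apply near_all. intros h c _. now apply Pol_continuous.
Qed.

Lemma Pol_mult f g : Pol f -> Pol g -> Pol (fun h c => f h c * g h c).
Proof.
  intros Hf Hg. induction Hf as [i a Ha|f f' _ IHf _ IHf'].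
  - induction Hg as [j b Hb|g g' _ IHg _ IHg'].
    + apply Pol_ext with (fun h c => (a h * b h) * c ^ (i + j)).
      * intros. rewrite pow_add. ring.
      * apply Pol_mono. now apply Ord_mult.
    + apply Pol_ext with (2 := Pol_add _ _ IHg IHg'). intros; simpl; ring.
  - apply Pol_ext with (2 := Pol_add _ _ IHf IHf'). intros; simpl; ring.
Qed.

Lemma Pol_nsum N f : (forall i, (i < N)%nat -> Pol (f i)) -> Pol (fun h c => nsum N (fun i => f i h c)).
Proof.
  induction N as [|N IH]; intros H; simpl.
  - apply (Pol_const (fun _ => 0)). apply Ord_zero.
  - apply Pol_add; [apply IH; intros; apply H; lia|apply H; lia].
Qed.

(** The factor [h] pays for the extra power of [c] that integration produces. *)
Lemma Pol_primitive g : Pol g -> exists G, Pol G /\ (forall h, G h 0 = 0) /\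
  forall h c, is_derive (G h) c (h * g h c).
Proof.
  induction 1 as [i a Ha|f g _ [F [HF [F0 dF]]] _ [G [HG [G0 dG]]]].
  - assert (0 <= INR i) by apply pos_INR.
    exists (fun h c => (h * a h / (INR i + 1)) * c ^ S i). split; [|split].
    + apply Pol_mono. apply Ord_ext_all with (fun h _ => / (INR i + 1) * (h * a h)).
      * intros; field; lra.
      * apply Ord_scal. now apply (Ord_step_mult i (fun h _ => a h)).
    + intros; simpl; ring.
    + intros h c. auto_derive; [easy|].
      replace (match i with O => 1 | S _ => INR i + 1 end) with (INR i + 1)
        by (destruct i; simpl; ring).
      field. lra.
  - exists (fun h c => F h c + G h c). split; [|split].
    + now apply Pol_add.
    + intros; rewrite F0, G0; ring.
    + intros h c. rewrite Rmult_plus_distr_l. now apply (is_derive_plus (F h) (G h)).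
Qed.

Lemma App_Pol n f : Pol f -> App n f.
Proof.
  intros H. exists f. split; [easy|]. apply Ord_ext_all with (fun _ _ => 0); [intros; ring|].
  apply Ord_zero.
Qed.

Lemma App_Ord0 n f : App n f -> Ord 0 f.
Proof.
  intros [g [Hg H]]. apply Ord_ext_all with (fun h c => g h c + (f h c - g h c)); [intros; ring|].
  apply Ord_plus; [now apply Pol_Ord|]. apply Ord_le with n; [lia|easy].
Qed.

Lemma App_0 f : Ord 0 f -> App 0 f.
Proof.
  intros H. exists (fun _ _ => 0). split; [apply (Pol_const (fun _ => 0)), Ord_const|].
  apply Ord_ext_all with f; [intros; ring|easy].
Qed.

Lemma App_le n k f : (k <= n)%nat -> App n f -> App k f.
Proof. intros Hk [g [Hg H]]. exists g. split; [easy|]. now apply Ord_le with n. Qed.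

Lemma App_plus n f g : App n f -> App n g -> App n (fun h c => f h c + g h c).
Proof.
  intros [f' [Pf Hf]] [g' [Pg Hg]]. exists (fun h c => f' h c + g' h c).
  split; [now apply Pol_add|].
  apply Ord_ext_all with (2 := Ord_plus _ _ _ Hf Hg). intros; ring.
Qed.

Lemma App_mult n f g : App n f -> App n g -> App n (fun h c => f h c * g h c).
Proof.
  intros Af Ag. assert (Bg := App_Ord0 _ _ Ag).
  destruct Af as [f' [Pf Hf]]. destruct Ag as [g' [Pg Hg]]. exists (fun h c => f' h c * g' h c).
  split; [now apply Pol_mult|].
  apply Ord_ext_all with (fun h c => (f h c - f' h c) * g h c + f' h c * (g h c - g' h c));
    [intros; ring|].
  apply Ord_plus.
  - rewrite <- (Nat.add_0_r n). now apply Ord_mult.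
  - apply (Ord_mult 0 n); [now apply Pol_Ord|easy].
Qed.

Lemma App_const n a : App n (fun _ _ => a).
Proof. apply App_Pol. apply (Pol_const (fun _ => a)). apply Ord_const. Qed.

Lemma App_opp n f : App n f -> App n (fun h c => - f h c).
Proof.
  intros H. assert (E := App_mult _ _ _ (App_const n (-1)) H).
  destruct E as [g [Hg E]]. exists g. split; [easy|].
  apply Ord_ext_all with (2 := E). intros; ring.
Qed.

Lemma App_minus n f g : App n f -> App n g -> App n (fun h c => f h c - g h c).
Proof. intros. apply App_plus; [easy|]. now apply App_opp. Qed.

Lemma App_fsum n m (f : Fin.t m -> R -> R -> R) : (forall i, App n (f i)) ->
  App n (fun h c => fsum m (fun i => f i h c)).
Proof.
  induction m as [|m IH]; intros H; simpl; [apply App_const|].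
  apply App_plus; [apply H | apply (IH (fun i => f (Fin.FS i))); intros; apply H].
Qed.

(** The primitive of the polynomial part of [w], shifted by the initial value, approximates [f]; the
    difference vanishes at 0, so the remainder gains an order by [Ord_derive]. *)
Lemma App_primitive n f w : eventually_derive f w -> App n w -> Ord 0 (fun h _ => f h 0) ->
  App (S n) f.
Proof.
  intros Hd [g [Pg Hg]] H0. destruct (Pol_primitive g Pg) as [G [PG [G0 dG]]].
  exists (fun h c => f h 0 + G h c). split.
  - apply Pol_add; [|easy]. now apply (Pol_const (fun h => f h 0)).
  - apply Ord_derive with n (fun h c => w h c - g h c); [| |easy|easy].
    + apply (near_imp _ _ Hd). intros h _ H1 c Hc.
      apply is_derive_ext with (fun c => (f h c - G h c) - f h 0); [intros; simpl; ring|].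
      replace (h * (w h c - g h c)) with (minus (minus (h * w h c) (h * g h c)) 0)
        by (unfold minus, plus, opp; simpl; ring).
      apply @is_derive_minus; [|apply @is_derive_const].
      apply (is_derive_minus (f h) (G h)); [now apply H1 | apply dG].
    + apply Ord_ext_all with (fun _ _ => 0); [intros; rewrite G0; ring|apply Ord_zero].
Qed.

(** * Legendre projection of families *)

Lemma Ord_legendre_proj s n f : eventually_continuous f -> Ord n f ->
  Ord n (fun h => legendre_proj s (f h)).
Proof.
  intros Hc Hf. unfold legendre_proj.
  apply (Ord_nsum n s (fun j h c => P j c * RInt (fun y => P j y * f h y) 0 1)). intros j _.
  apply (Ord_mult 0 n).
  - apply Ord_continuous. intros; apply continuous_P.
  - apply (Ord_RInt n (fun h y => P j y * f h y)).
    + apply (near_imp _ _ Hc). intros h _ H1 c H.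
      apply continuous_Rmult; [apply continuous_P|now apply H1].
    + apply (Ord_mult 0 n); [|easy]. apply Ord_continuous. intros; apply continuous_P.
Qed.

(** Powers below [s] are fixed. A power [i >= s] spreads over degrees [l < s], and its coefficient
    of order [i] is in particular of order [l]. *)
Lemma Pol_legendre_proj s f : Pol f -> Pol (fun h => legendre_proj s (f h)).
Proof.
  induction 1 as [i a Ha|f g Pf IHf Pg IHg].
  - destruct (Nat.lt_ge_cases i s) as [Hi|Hi].
    + apply Pol_ext with (fun h c => a h * c ^ i); [|now apply Pol_mono].
      intros h c. rewrite legendre_proj_scal by (intros; apply continuous_pow_R).
      now rewrite legendre_proj_pow.
    + apply Pol_ext with (fun h c => nsum s (fun j => nsum (S j) (fun l =>
        (a h * (sqrt (INR (2 * j + 1)) * legendre_coef j l * RInt (fun y => P j y * y ^ i) 0 1)) * c ^ l))).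
      * intros h c. rewrite legendre_proj_scal by (intros; apply continuous_pow_R).
        unfold legendre_proj. rewrite <- nsum_scal. apply nsum_ext. intros j _.
        rewrite P_nsum.
        transitivity ((a h * sqrt (INR (2 * j + 1)) * RInt (fun y => P j y * y ^ i) 0 1) *
          nsum (S j) (fun l => legendre_coef j l * c ^ l)); [|ring].
        rewrite <- nsum_scal. apply nsum_ext. intros; ring.
      * apply (Pol_nsum s (fun j h c => nsum (S j) (fun l =>
        (a h * (sqrt (INR (2 * j + 1)) * legendre_coef j l * RInt (fun y => P j y * y ^ i) 0 1)) * c ^ l))).
        intros j Hj.
        apply (Pol_nsum (S j) (fun l h c =>
        (a h * (sqrt (INR (2 * j + 1)) * legendre_coef j l * RInt (fun y => P j y * y ^ i) 0 1)) * c ^ l)).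
        intros l Hl.
        apply (Pol_mono l (fun h => a h * (sqrt (INR (2 * j + 1)) * legendre_coef j l * RInt (fun y => P j y * y ^ i) 0 1))).
        apply Ord_le with i; [lia|]. rewrite <- (Nat.add_0_r i). apply Ord_mult; [easy|apply Ord_const].
  - apply Pol_ext with (2 := Pol_add _ _ IHf IHg). intros h c. symmetry.
    apply legendre_proj_plus; intros; now apply Pol_continuous.
Qed.

Lemma legendre_proj_minus s (f g : R -> R) x :
  (forall x, 0 <= x <= 1 -> continuous f x) -> (forall x, 0 <= x <= 1 -> continuous g x) ->
  legendre_proj s (fun y => f y - g y) x = legendre_proj s f x - legendre_proj s g x.
Proof.
  intros Hf Hg.
  replace (fun y => f y - g y) with (fun y => f y + -1 * g y)
    by (apply functional_extensionality; intros; ring).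
  rewrite legendre_proj_plus, legendre_proj_scal; [ring|easy|easy|].
  intros. apply continuous_Rmult; [apply continuous_const|auto].
Qed.

Lemma App_legendre_proj s n f : eventually_continuous f -> App n f ->
  App n (fun h => legendre_proj s (f h)).
Proof.
  intros Hc [g [Pg Hg]]. exists (fun h => legendre_proj s (g h)).
  split; [now apply Pol_legendre_proj|].
  apply Ord_ext with (fun h => legendre_proj s (fun c => f h c - g h c)).
  - apply (near_imp _ _ Hc). intros h _ H1 c _. apply legendre_proj_minus.
    + intros; apply H1; lra.
    + intros; now apply Pol_continuous.
  - apply (Ord_legendre_proj s n (fun h c => f h c - g h c)); [|easy].
    apply eventually_continuous_minus; [easy|now apply Pol_eventually_continuous].
Qed.

(** On the polynomial part the error is zero for powers below [s], and every other monomial is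
    O(h^s) by itself; on the remainder, boundedness of the projection suffices. *)
Lemma Ord_legendre_error s f : eventually_continuous f -> App s f ->
  Ord s (fun h c => legendre_proj s (f h) c - f h c).
Proof.
  intros Hc [g [Pg Hg]].
  assert (Hcr : eventually_continuous (fun h c => f h c - g h c)).
  { apply eventually_continuous_minus; [easy|now apply Pol_eventually_continuous]. }
  apply Ord_ext with (fun h c => legendre_proj s (fun c => f h c - g h c) c - (f h c - g h c) +
    (legendre_proj s (g h) c - g h c)).
  - apply (near_imp _ _ Hc). intros h _ H1 c _. rewrite legendre_proj_minus; [ring|..].
    + intros; apply H1; lra.
    + intros; now apply Pol_continuous.
  - apply Ord_plus.
    + apply Ord_minus; [|easy]. now apply (Ord_legendre_proj s s (fun h c => f h c - g h c)).
    + clear -Pg. induction Pg as [i a Ha|f g Pf IHf Pg IHg].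
      * destruct (Nat.lt_ge_cases i s) as [Hi|Hi].
        -- apply Ord_ext_all with (2 := Ord_zero s). intros h c.
           rewrite legendre_proj_scal by (intros; apply continuous_pow_R).
           rewrite legendre_proj_pow by easy. ring.
        -- assert (Hm : Ord s (fun h c => a h * c ^ i)).
           { apply Ord_mono. now apply Ord_le with i. }
           apply Ord_minus; [|easy].
           apply (Ord_legendre_proj s s (fun h c => a h * c ^ i)); [|easy].
           apply Pol_eventually_continuous. now apply Pol_mono.
      * apply Ord_ext_all with (2 := Ord_plus _ _ _ IHf IHg). intros h c.
        rewrite legendre_proj_plus; [ring|..]; intros; now apply Pol_continuous.
Qed.

Lemma continuous_legendre_proj s f x : continuous (legendre_proj s f) x.
Proof.
  unfold legendre_proj. apply continuous_nsum. intros j _.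
  apply continuous_Rmult; [apply continuous_P|apply continuous_const].
Qed.

(** Self-adjointness of the projection, which fixes the power [x ^ i]. *)
Lemma RInt_legendre_error_pow s (f : R -> R) i : (i < s)%nat ->
  (forall x, 0 <= x <= 1 -> continuous f x) ->
  RInt (fun x => x ^ i * (legendre_proj s f x - f x)) 0 1 = 0 :> R.
Proof.
  intros Hi Hf.
  assert (Hpf : forall (g : R -> R), (forall x, 0 <= x <= 1 -> continuous g x) ->
     ex_RInt (fun x => x ^ i * g x) 0 1).
  { intros g Hg. apply @ex_RInt_continuous. intros x. rewrite Rmin_left, Rmax_right by lra.
    intros. apply continuous_Rmult; [apply continuous_pow_R|now apply Hg]. }
  rewrite (RInt_ext01 _ (fun x => minus (x ^ i * legendre_proj s f x) (x ^ i * f x))).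
  2:{ intros. unfold minus, plus, opp; simpl. ring. }
  rewrite (RInt_minus (fun x => x ^ i * legendre_proj s f x) (fun x => x ^ i * f x))
    by (apply Hpf; intros; auto using continuous_legendre_proj).
  assert (E : RInt (fun x => x ^ i * legendre_proj s f x) 0 1 = RInt (fun x => x ^ i * f x) 0 1 :> R).
  (* Both integrals equal the sum of products of the Legendre coefficients of [f] and of the
     power. *)
  { transitivity (nsum s (fun j => RInt (fun y => P j y * f y) 0 1 * RInt (fun x => P j x * x ^ i) 0 1)).
    - assert (Hex : forall j, ex_RInt (fun x => P j x * x ^ i) 0 1).
      { intros. apply ex_RInt_cont. intros; apply continuous_Rmult; [apply continuous_P|apply continuous_pow_R]. }
      rewrite (nsum_ext _ _ (fun j => RInt (fun x => RInt (fun y => P j y * f y) 0 1 * (P j x * x ^ i)) 0 1)).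
      2:{ intros. now rewrite RInt_scal_R. }
      rewrite <- (proj2 (ex_RInt_nsum s (fun j x => RInt (fun y => P j y * f y) 0 1 * (P j x * x ^ i)) 0 1
        (fun j _ => ex_RInt_scal_R _ _ _ _ (Hex j)))).
      apply RInt_ext01. intros x _. unfold legendre_proj. rewrite <- nsum_scal.
      apply nsum_ext. intros; ring.
    - rewrite (nsum_ext _ _ (fun j => RInt (fun x => RInt (fun y => P j y * y ^ i) 0 1 * (P j x * f x)) 0 1)).
      2:{ intros. rewrite RInt_scal_R by now apply ex_RInt_P_mult. apply Rmult_comm. }
      rewrite <- (proj2 (ex_RInt_nsum s (fun j x => RInt (fun y => P j y * y ^ i) 0 1 * (P j x * f x)) 0 1
        (fun j _ => ex_RInt_scal_R _ _ _ _ (ex_RInt_P_mult j f Hf)))).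
      apply RInt_ext01. intros x _. rewrite <- (legendre_proj_pow s i x Hi) at 1.
      unfold legendre_proj. rewrite Rmult_comm, <- nsum_scal. apply nsum_ext. intros; ring. }
  rewrite E. unfold minus, plus, opp; simpl. ring.
Qed.

Lemma RInt_plus01 (f g : R -> R) : (forall x, 0 <= x <= 1 -> continuous f x) ->
  (forall x, 0 <= x <= 1 -> continuous g x) ->
  RInt (fun x => f x + g x) 0 1 = RInt f 0 1 + RInt g 0 1 :> R.
Proof.
  intros Hf Hg. apply (RInt_plus f g); apply @ex_RInt_continuous; intros x;
    rewrite Rmin_left, Rmax_right by lra; auto.
Qed.

Lemma Ord_RInt_plus n (f g : R -> R -> R) : eventually_continuous f -> eventually_continuous g ->
  Ord n (fun h _ => RInt (f h) 0 1) -> Ord n (fun h _ => RInt (g h) 0 1) ->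
  Ord n (fun h _ => RInt (fun c => f h c + g h c) 0 1).
Proof.
  intros Cf Cg Hf Hg. apply Ord_ext with (2 := Ord_plus _ _ _ Hf Hg).
  apply (near_imp2 _ _ _ Cf Cg). intros h _ H1 H2 c _.
  rewrite RInt_plus01; [easy|..]; intros; [apply H1|apply H2]; lra.
Qed.

Lemma Ord_RInt_ext n (f g : R -> R -> R) :
  at_right 0 (fun h => forall c, 0 <= c <= 1 -> f h c = g h c) ->
  Ord n (fun h _ => RInt (f h) 0 1) -> Ord n (fun h _ => RInt (g h) 0 1).
Proof.
  intros E. apply Ord_ext. apply (near_imp _ _ E). intros h _ H c _.
  apply RInt_ext01. intros; now apply H.
Qed.

Lemma Ord_RInt_fsum n m (f : Fin.t m -> R -> R -> R) :
  (forall i, eventually_continuous (f i)) ->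
  (forall i, Ord n (fun h _ => RInt (f i h) 0 1)) ->
  Ord n (fun h _ => RInt (fun c => fsum m (fun i => f i h c)) 0 1).
Proof.
  induction m as [|m IH]; intros Hc H; simpl.
  - apply (Ord_RInt n (fun _ _ => 0)); [apply (eventually_continuous_const (fun _ => 0))|apply Ord_zero].
  - apply Ord_RInt_plus; auto.
    apply (eventually_continuous_fsum m (fun i => f (Fin.FS i))). auto.
Qed.

(* Superconvergence: a smooth weight only sees the projection error through the part of the
   weight orthogonal to polynomials of degree less than [s], itself of order [s]. *)
Lemma Ord_RInt_legendre_error s w f :
  eventually_continuous w -> eventually_continuous f -> App s w -> App s f ->
  Ord (2 * s) (fun h _ => RInt (fun c => w h c * (legendre_proj s (f h) c - f h c)) 0 1).
Proof.
  intros Cw Cf [g [Pg Hg]] Af.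
  assert (He := Ord_legendre_error s f Cf Af).
  assert (Ce : eventually_continuous (fun h c => legendre_proj s (f h) c - f h c)).
  { apply eventually_continuous_minus; [|easy].
    apply near_all. intros h c _. apply continuous_legendre_proj. }
  replace (2 * s)%nat with (s + s)%nat by lia.
  apply Ord_RInt_ext with (fun h c => (w h c - g h c) * (legendre_proj s (f h) c - f h c) +
     g h c * (legendre_proj s (f h) c - f h c)).
  { apply near_all. intros; ring. }
  assert (Cg := Pol_eventually_continuous g Pg).
  apply Ord_RInt_plus.
  - apply eventually_continuous_mult; [|easy]. now apply eventually_continuous_minus.
  - now apply eventually_continuous_mult.
  - apply (Ord_RInt (s + s) (fun h c => (w h c - g h c) * (legendre_proj s (f h) c - f h c))).
    + apply eventually_continuous_mult; [|easy]. now apply eventually_continuous_minus.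
    + now apply Ord_mult.
  - clear -Cf Pg He Ce. induction Pg as [i a Ha|g g' Pg IHg Pg' IHg'].
    + destruct (Nat.lt_ge_cases i s) as [Hi|Hi].
      * apply Ord_ext with (2 := Ord_zero (s + s)). apply (near_imp2 _ _ _ Cf Ce).
        intros h _ H1 H2 c _.
        rewrite (RInt_ext01 _ (fun c => a h * (c ^ i * (legendre_proj s (f h) c - f h c))))
          by (intros; ring).
        rewrite RInt_scal_R.
        -- rewrite RInt_legendre_error_pow; [ring|easy|]. intros; apply H1; lra.
        -- apply @ex_RInt_continuous. intros x. rewrite Rmin_left, Rmax_right by lra.
           intros. apply continuous_Rmult; [apply continuous_pow_R|apply H2; lra].
      * apply (Ord_RInt (s + s) (fun h c => a h * c ^ i * (legendre_proj s (f h) c - f h c))).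
        -- apply eventually_continuous_mult; [|easy]. apply Pol_eventually_continuous. now apply Pol_mono.
        -- apply Ord_mult; [|easy]. apply Ord_mono. now apply Ord_le with i.
    + apply Ord_RInt_ext with (fun h c => g h c * (legendre_proj s (f h) c - f h c) +
        g' h c * (legendre_proj s (f h) c - f h c)).
      { apply near_all. intros; ring. }
      apply Ord_RInt_plus; auto using eventually_continuous_mult, Pol_eventually_continuous.
Qed.

(** * Calculus in several variables *)

Definition vcons {n} (x : R) (y : Vec n) : Vec (S n) := fun i => Fin.caseS' i (fun _ => R) x y.

Lemma vcons_eta n (x : Vec (S n)) : x = vcons (x Fin.F1) (fun i => x (Fin.FS i)).
Proof. apply functional_extensionality. intros i. now pattern i; apply Fin.caseS'. Qed.

Lemma shift_vcons_F1 n x (y : Vec n) t : shift (vcons x y) Fin.F1 t = vcons (x + t) y.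
Proof.
  apply functional_extensionality. intros i. pattern i; apply Fin.caseS'; unfold shift.
  - destruct (Fin.eq_dec Fin.F1 Fin.F1); easy.
  - intros j. destruct (Fin.eq_dec Fin.F1 (Fin.FS j)); easy.
Qed.

Lemma shift_vcons_FS n x (y : Vec n) i t : shift (vcons x y) (Fin.FS i) t = vcons x (shift y i t).
Proof.
  apply functional_extensionality. intros j. pattern j; apply Fin.caseS'; unfold shift.
  - destruct (Fin.eq_dec (Fin.FS i) Fin.F1); easy.
  - intros k. simpl. destruct (Fin.eq_dec (Fin.FS i) (Fin.FS k)) as [E|E], (Fin.eq_dec i k) as [E'|E']; try easy.
    + now apply Fin.FS_inj in E.
    + now subst.
Qed.

(** Walk from [a] to [b] one coordinate at a time and apply the one-dimensional theorem on each leg.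
    Hence each partial derivative gets its own intermediate point. *)
Lemma partial_mean_value n (f : Vec n -> R) (df : Fin.t n -> Vec n -> R) :
  (forall i, is_partial f i (df i)) -> forall a b : Vec n, exists xi : Fin.t n -> Vec n,
  (forall i j, Rabs (xi i j - a j) <= Rabs (b j - a j)) /\
  f b - f a = fsum n (fun i => df i (xi i) * (b i - a i)).
Proof.
  induction n as [|n IH]; intros Hp a b.
  - exists (fun i => a). split; [intros i; inversion i|]. simpl.
    replace b with a; [ring|]. apply functional_extensionality. intros i; inversion i.
  - rewrite (vcons_eta _ a), (vcons_eta _ b).
    set (a0 := a Fin.F1). set (a' := fun i => a (Fin.FS i)).
    set (b0 := b Fin.F1). set (b' := fun i => b (Fin.FS i)).
    destruct (IH (fun y => f (vcons b0 y)) (fun i y => df (Fin.FS i) (vcons b0 y))) with (a := a') (b := b')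
      as [xi [Hxi E]].
    { intros i y. specialize (Hp (Fin.FS i) (vcons b0 y)).
      replace (fun t => f (vcons b0 (shift y i t))) with (fun t => f (shift (vcons b0 y) (Fin.FS i) t));
        [easy|]. apply functional_extensionality. intros t. now rewrite shift_vcons_FS. }
    assert (Hd : forall t : R, is_derive (fun t : R => f (vcons t a')) t (df Fin.F1 (vcons t a'))).
    { intros t. specialize (Hp Fin.F1 (vcons t a')). apply is_derive_Reals in Hp.
      apply is_derive_ext with (fun r : R => f (shift (vcons t a') Fin.F1 (r - t))).
      - intros r. rewrite shift_vcons_F1. now rewrite (Rplus_minus t r).
      - replace (df Fin.F1 (vcons t a')) with (scal 1 (df Fin.F1 (vcons t a')))
          by apply Rmult_1_l.
        apply (is_derive_comp (fun u => f (shift (vcons t a') Fin.F1 u)) (fun r : R => r - t)).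
        + unfold Rminus; rewrite Rplus_opp_r; easy.
        + auto_derive; [easy|reflexivity]. }
    destruct (MVT_gen (fun t => f (vcons t a')) a0 b0 (fun t => df Fin.F1 (vcons t a'))) as [x [Hx E2]].
    + intros; apply Hd.
    + intros x _. apply continuity_pt_filterlim. apply @ex_derive_continuous. eexists. apply Hd.
    (* The first leg moves the head while the tail rests at [a']; the later legs start with the head
       already at [b0]. *)
    + exists (fun i => Fin.caseS' i (fun _ => Vec (S n)) (vcons x a') (fun j => vcons b0 (xi j))).
      split.
      * intros i j. pattern i; apply Fin.caseS'; pattern j; apply Fin.caseS'; simpl.
        -- unfold Rmin, Rmax in Hx. unfold Rabs.
           destruct (Rle_dec a0 b0), (Rcase_abs (x - a0)), (Rcase_abs (b0 - a0)); lra.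
        -- intros p. rewrite Rminus_diag, Rabs_R0. apply Rabs_pos.
        -- intros p. lra.
        -- intros p q. apply Hxi.
      * simpl. fold a0 b0. rewrite <- E2.
        transitivity ((f (vcons b0 a') - f (vcons a0 a')) + (f (vcons b0 b') - f (vcons b0 a'))); [ring|].
        rewrite E. easy.
Qed.

(** Carathéodory's form of differentiability; with its converse below it turns the chain rule into
    continuity of sums and products. *)
Lemma is_derive_slope (f : R -> R) x l : is_derive f x l ->
  exists g, continuous g x /\ g x = l /\ forall y, f y - f x = g y * (y - x).
Proof.
  intros H. apply is_derive_Reals in H.
  exists (fun y => if Req_EM_T y x then l else (f y - f x) / (y - x)). repeat split.
  - apply filterlim_locally. intros eps.
    destruct (H eps (cond_pos eps)) as [d Hd]. exists d. intros y Hy.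
    change (Rabs (y - x) < d) in Hy.
    change (Rabs ((if Req_EM_T y x then l else (f y - f x) / (y - x)) -
                  (if Req_EM_T x x then l else (f x - f x) / (x - x))) < eps).
    destruct (Req_EM_T x x); [|easy]. destruct (Req_EM_T y x) as [E|E].
    + rewrite Rminus_diag, Rabs_R0. apply cond_pos.
    + specialize (Hd (y - x)). rewrite Rplus_minus in Hd. apply Hd; [now apply Rminus_eq_contra|easy].
  - destruct (Req_EM_T x x); easy.
  - intros y. destruct (Req_EM_T y x) as [->|E]; [ring|]. field. lra.
Qed.

Lemma slope_is_derive (f g : R -> R) x : continuous g x ->
  (forall y, f y - f x = g y * (y - x)) -> is_derive f x (g x).
Proof.
  intros Hg H. apply is_derive_Reals. intros eps Heps.
  destruct (proj1 (filterlim_locally _ _) Hg (mkposreal eps Heps)) as [d Hd].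
  exists d. intros h Hh Hhd. rewrite H. replace (x + h - x) with h by ring.
  replace (g (x + h) * h / h) with (g (x + h)) by (field; easy).
  apply (Hd (x + h)). change (Rabs (x + h - x) < d). now replace (x + h - x) with h by ring.
Qed.

Lemma continuous_cont_comp n (f : Vec n -> R) (X : Fin.t n -> R -> R) c :
  cont f -> (forall i, continuous (X i) c) -> continuous (fun c => f (fun i => X i c)) c.
Proof.
  intros Hf HX. apply filterlim_locally. intros eps.
  destruct (Hf (fun i => X i c) eps (cond_pos eps)) as [d [Hd H]].
  assert (HF : locally c (fun y => forall i, Rabs (X i y - X i c) < d)).
  { apply (filter_forall_fin (locally c) n (fun i y => Rabs (X i y - X i c) < d)).
    intros i. apply (proj1 (filterlim_locally _ _) (HX i) (mkposreal d Hd)). }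
  apply filter_imp with (2 := HF). intros y Hy. now apply H.
Qed.

(** The composite has the slope [df i (xi y i) * g i y] summed over [i], with [g i] the slope of
    [X i] and [xi] the mean value points. It is continuous at [c] because the bound on [xi] squeezes
    these points to [X c]. *)
Lemma is_derive_partial_comp n (f : Vec n -> R) df (X : Fin.t n -> R -> R) dX c :
  (forall i, is_partial f i (df i)) -> (forall i, cont (df i)) ->
  (forall i, is_derive (X i) c (dX i)) ->
  is_derive (fun c => f (fun i => X i c)) c (fsum n (fun i => df i (fun j => X j c) * dX i)).
Proof.
  intros Hp Hc HX.
  assert (Hs : forall i, exists g, continuous g c /\ g c = dX i /\
    forall y, X i y - X i c = g y * (y - c)) by (intros; now apply is_derive_slope).
  set (g i := proj1_sig (constructive_indefinite_description _ (Hs i))).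
  assert (Hg : forall i, continuous (g i) c /\ g i c = dX i /\
    forall y, X i y - X i c = g i y * (y - c)).
  { intros i. unfold g. apply (proj2_sig (constructive_indefinite_description _ (Hs i))). }
  assert (Hm := fun y => partial_mean_value n f df Hp (fun i => X i c) (fun i => X i y)).
  set (xi y := proj1_sig (constructive_indefinite_description _ (Hm y))).
  assert (Hxi : forall y, (forall i j, Rabs (xi y i j - X j c) <= Rabs (X j y - X j c)) /\
     f (fun i => X i y) - f (fun i => X i c) = fsum n (fun i => df i (xi y i) * (X i y - X i c))).
  { intros y. unfold xi. apply (proj2_sig (constructive_indefinite_description _ (Hm y))). }
  clearbody g xi.
  assert (Hxic : forall i j, xi c i j = X j c).
  { intros i j. destruct (Hxi c) as [H _]. specialize (H i j).
    rewrite (Rminus_diag (X j c)), Rabs_R0 in H.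
    assert (E := Rabs_pos (xi c i j - X j c)).
    destruct (Req_dec (xi c i j - X j c) 0) as [Hz|Hz]; [lra|].
    apply Rabs_pos_lt in Hz. lra. }
  replace (fsum n (fun i => df i (fun j => X j c) * dX i))
    with ((fun y => fsum n (fun i => df i (fun j => xi y i j) * g i y)) c).
  - apply (slope_is_derive _ (fun y => fsum n (fun i => df i (fun j => xi y i j) * g i y))).
    + apply continuous_fsum. intros i. apply continuous_Rmult; [|apply Hg].
      apply (continuous_cont_comp n (df i) (fun j y => xi y i j)); [apply Hc|].
      intros j. apply filterlim_locally. intros eps.
      assert (HXc : continuous (X j) c) by (apply @ex_derive_continuous; eexists; apply HX).
      apply filter_imp with (2 := proj1 (filterlim_locally _ _) HXc eps).
      intros y Hy. change (Rabs (X j y - X j c) < eps) in Hy.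
      change (Rabs (xi y i j - xi c i j) < eps). rewrite Hxic.
      apply Rle_lt_trans with (2 := Hy). apply Hxi.
    + intros y. rewrite (proj2 (Hxi y)), (Rmult_comm (fsum n _)), <- fsum_scal. apply fsum_ext. intros i.
      destruct (Hg i) as [_ [_ E]]. rewrite E. change (fun j => xi y i j) with (xi y i). ring.
  - apply fsum_ext. intros i. destruct (Hg i) as [_ [E _]]. rewrite E. f_equal. f_equal.
    apply functional_extensionality. intros j. apply Hxic.
Qed.

(** * Partial derivatives and local Taylor bounds *)

Definition partial {n} (i : Fin.t n) (f : Vec n -> R) : Vec n -> R :=
  fun x => Derive (fun t => f (shift x i t)) 0.

Lemma is_partial_unique n (f g : Vec n -> R) i : is_partial f i g -> g = partial i f.
Proof.
  intros H. apply functional_extensionality. intros x. symmetry.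
  apply is_derive_unique, is_derive_Reals, H.
Qed.

Lemma smooth_cont n (f : Vec n -> R) : smooth f -> cont f.
Proof. intros H. apply (H 0%nat). Qed.

Lemma smooth_is_partial n (f : Vec n -> R) i : smooth f -> is_partial f i (partial i f).
Proof.
  intros H. destruct (proj2 (H 1%nat) i) as [g [Hg _]].
  now rewrite <- (is_partial_unique _ _ _ _ Hg).
Qed.

(** [Ck] supplies a possibly different derivative at each order; uniqueness identifies all of them
    with [partial i f]. *)
Lemma smooth_partial n (f : Vec n -> R) i : smooth f -> smooth (partial i f).
Proof.
  intros H k. destruct (proj2 (H (S k)) i) as [g [Hg Hk]].
  now rewrite <- (is_partial_unique _ _ _ _ Hg).
Qed.

Definition in_box {n} (x0 : Vec n) (d : R) (x : Vec n) : Prop := forall i, Rabs (x i - x0 i) < d.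

(* One small parameter [d] serves as radius and, through [/ d], as bound, so that finitely many
   such statements combine by intersecting filters. *)
Lemma cont_locally_bounded n (f : Vec n -> R) x0 : cont f ->
  at_right 0 (fun d => forall x, in_box x0 d x -> Rabs (f x) <= / d).
Proof.
  intros Hf. destruct (Hf x0 1 Rlt_0_1) as [d [Hd H]].
  assert (Hp := Rabs_pos (f x0)).
  assert (Hq : 0 < / (Rabs (f x0) + 1)) by (apply Rinv_0_lt_compat; lra).
  apply (near_imp2 _ _ _ (near_lt d Hd) (near_lt _ Hq)). intros e _ He1 He2 x Hx.
  assert (Hb : Rabs (f x - f x0) < 1).
  { apply H. intros i. apply Rlt_trans with (1 := Hx i). lra. }
  replace (f x) with (f x0 + (f x - f x0)) by ring.
  apply Rle_trans with (1 := Rabs_triang _ _).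
  apply Rle_trans with (Rabs (f x0) + 1); [lra|].
  rewrite <- (Rinv_inv (Rabs (f x0) + 1)). apply Rinv_le_contravar; lra.
Qed.

Lemma smooth_locally_Lipschitz n (f : Vec n -> R) x0 : smooth f ->
  at_right 0 (fun d => forall a b M, in_box x0 d a -> in_box x0 d b -> 0 <= M ->
    (forall i, Rabs (b i - a i) <= M) -> Rabs (f b - f a) <= / d * M).
Proof.
  intros Hf.
  assert (HF := filter_forall_fin (at_right 0) n _ (fun i =>
    cont_locally_bounded n (partial i f) x0 (smooth_cont _ _ (smooth_partial _ _ i Hf)))).
  destruct (filter_ex _ (filter_and _ _ (near_lt 1 Rlt_0_1) HF)) as [d [Hd HB]].
  assert (Hn := pos_INR n).
  assert (Hi : 0 < / d) by (apply Rinv_0_lt_compat; lra).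
  assert (HK : 0 < / (INR n * / d + 1)) by (apply Rinv_0_lt_compat; nra).
  (* An intermediate point is within [|b - a| + |a - x0| < 3 * e] of [x0] in each coordinate, hence
     the radius [d / 3]; the second cap gives [INR n * / d <= / e]. *)
  apply (near_imp2 _ _ _ (near_lt (d / 3) ltac:(lra)) (near_lt _ HK)).
  intros e _ He1 He2 a b M Ha Hb HM0 HM.
  destruct (partial_mean_value n f (fun i => partial i f)
    (fun i => smooth_is_partial _ _ i Hf) a b) as [xi [Hxi E]].
  rewrite E. apply Rle_trans with (INR n * (/ d * M)).
  - apply Rabs_fsum_le. intros i. rewrite Rabs_mult.
    apply Rmult_le_compat; auto using Rabs_pos.
    apply HB. intros j.
    replace (xi i j - x0 j) with ((xi i j - a j) + (a j - x0 j)) by ring.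
    apply Rle_lt_trans with (1 := Rabs_triang _ _).
    specialize (Hxi i j). specialize (Ha j). specialize (Hb j).
    replace (b j - a j) with ((b j - x0 j) + - (a j - x0 j)) in Hxi by ring.
    assert (T := Rabs_triang (b j - x0 j) (- (a j - x0 j))). rewrite Rabs_Ropp in T. lra.
  - rewrite <- Rmult_assoc. apply Rmult_le_compat_r; [easy|].
    apply Rle_trans with (INR n * / d + 1); [lra|].
    rewrite <- (Rinv_inv (INR n * / d + 1)). apply Rinv_le_contravar; lra.
Qed.

(** After the mean value theorem, only the change of the partial derivatives between [a] and the
    intermediate points remains, and the Lipschitz bound for them supplies the second factor [M]. *)
Lemma smooth_locally_quadratic n (f : Vec n -> R) x0 : smooth f ->
  at_right 0 (fun d => forall a b M, in_box x0 d a -> in_box x0 d b -> 0 <= M ->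
    (forall i, Rabs (b i - a i) <= M) ->
    Rabs (f b - f a - fsum n (fun i => partial i f a * (b i - a i))) <= / d * (M * M)).
Proof.
  intros Hf.
  assert (HF := filter_forall_fin (at_right 0) n _ (fun i =>
    smooth_locally_Lipschitz n (partial i f) x0 (smooth_partial _ _ i Hf))).
  destruct (filter_ex _ (filter_and _ _ (near_lt 1 Rlt_0_1) HF)) as [d [Hd HB]].
  assert (Hn := pos_INR n).
  assert (Hi : 0 < / d) by (apply Rinv_0_lt_compat; lra).
  assert (HK : 0 < / (INR n * / d + 1)) by (apply Rinv_0_lt_compat; nra).
  apply (near_imp2 _ _ _ (near_lt (d / 3) ltac:(lra)) (near_lt _ HK)).
  intros e _ He1 He2 a b M Ha Hb HM0 HM.
  destruct (partial_mean_value n f (fun i => partial i f)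
    (fun i => smooth_is_partial _ _ i Hf) a b) as [xi [Hxi E]].
  rewrite E.
  replace (fsum n (fun i => partial i f (xi i) * (b i - a i)) -
     fsum n (fun i => partial i f a * (b i - a i)))
    with (fsum n (fun i => (partial i f (xi i) - partial i f a) * (b i - a i))).
  2:{ transitivity (fsum n (fun i => partial i f (xi i) * (b i - a i)) +
        -1 * fsum n (fun i => partial i f a * (b i - a i))); [|ring].
      rewrite <- fsum_scal, <- fsum_plus. apply fsum_ext. intros; ring. }
  apply Rle_trans with (INR n * ((/ d * M) * M)).
  - apply Rabs_fsum_le. intros i. rewrite Rabs_mult.
    apply Rmult_le_compat; auto using Rabs_pos.
    apply HB; [| |easy|].
    + intros j. apply Rlt_trans with (1 := Ha j). lra.
    + intros j.
      replace (xi i j - x0 j) with ((xi i j - a j) + (a j - x0 j)) by ring.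
      apply Rle_lt_trans with (1 := Rabs_triang _ _).
      specialize (Hxi i j). specialize (Ha j). specialize (Hb j).
      replace (b j - a j) with ((b j - x0 j) + - (a j - x0 j)) in Hxi by ring.
      assert (T := Rabs_triang (b j - x0 j) (- (a j - x0 j))). rewrite Rabs_Ropp in T. lra.
    + intros j. apply Rle_trans with (2 := HM j). apply Hxi.
  - replace (INR n * (/ d * M * M)) with ((INR n * / d) * (M * M)) by ring.
    apply Rmult_le_compat_r; [nra|].
    apply Rle_trans with (INR n * / d + 1); [lra|].
    rewrite <- (Rinv_inv (INR n * / d + 1)). apply Rinv_le_contravar; lra.
Qed.

(** * Smooth functions of families *)

Lemma Ord_in_box n (X : Fin.t n -> R -> R -> R) x0 d : 0 < d ->
  (forall i, Ord 1 (fun h c => X i h c - x0 i)) ->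
  at_right 0 (fun h => forall c, 0 <= c <= 1 -> in_box x0 d (fun i => X i h c)).
Proof.
  intros Hd HX. destruct (Ord_fin 1 n _ HX) as [K [HK H]].
  assert (Hq : 0 < d / K) by (apply Rdiv_lt_0_compat; lra).
  apply (near_imp2 _ _ _ H (near_lt _ Hq)). intros h Hh H1 H2 c Hc i.
  apply Rle_lt_trans with (1 := H1 i c Hc). simpl.
  apply Rlt_le_trans with (K * (d / K)); [nra|]. right. field. lra.
Qed.

Lemma Ord0_comp n (f : Vec n -> R) (X : Fin.t n -> R -> R -> R) x0 : cont f ->
  (forall i, Ord 1 (fun h c => X i h c - x0 i)) -> Ord 0 (fun h c => f (fun i => X i h c)).
Proof.
  intros Hf HX.
  destruct (filter_ex _ (filter_and _ _ (near_lt 1 Rlt_0_1) (cont_locally_bounded n f x0 Hf)))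
    as [d [Hd H]].
  exists (/ d). split; [apply Rinv_0_lt_compat; lra|].
  apply (near_imp _ _ (Ord_in_box n X x0 d (proj1 Hd) HX)).
  intros h _ H1 c Hc. simpl. rewrite Rmult_1_r. apply H. now apply H1.
Qed.

Lemma Ord_Lipschitz n k (f : Vec n -> R) (X Y : Fin.t n -> R -> R -> R) x0 : smooth f ->
  (forall i, Ord 1 (fun h c => X i h c - x0 i)) ->
  (forall i, Ord 1 (fun h c => Y i h c - x0 i)) ->
  (forall i, Ord k (fun h c => X i h c - Y i h c)) ->
  Ord k (fun h c => f (fun i => X i h c) - f (fun i => Y i h c)).
Proof.
  intros Hf HX HY HXY. destruct (Ord_fin k n _ HXY) as [K [HK HK']].
  destruct (filter_ex _ (filter_and _ _ (near_lt 1 Rlt_0_1) (smooth_locally_Lipschitz n f x0 Hf)))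
    as [d [Hd H]].
  assert (Hi : 0 < / d) by (apply Rinv_0_lt_compat; lra).
  exists (/ d * K). split; [nra|].
  apply (near_imp2 _ _ _ HK' (filter_and _ _ (Ord_in_box n X x0 d (proj1 Hd) HX)
    (Ord_in_box n Y x0 d (proj1 Hd) HY))).
  intros h Hh H1 [H2 H3] c Hc. rewrite Rmult_assoc.
  assert (0 < h ^ k) by (apply pow_lt; lra).
  apply H; [now apply H3|now apply H2|nra|]. intros i. now apply H1.
Qed.

Lemma Ord_quadratic n k (f : Vec n -> R) (X Y : Fin.t n -> R -> R -> R) x0 : smooth f ->
  (forall i, Ord 1 (fun h c => X i h c - x0 i)) ->
  (forall i, Ord 1 (fun h c => Y i h c - x0 i)) ->
  (forall i, Ord k (fun h c => X i h c - Y i h c)) ->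
  Ord (k + k) (fun h c => f (fun i => X i h c) - f (fun i => Y i h c) -
    fsum n (fun i => partial i f (fun j => X j h c) * (X i h c - Y i h c))).
Proof.
  intros Hf HX HY HXY. destruct (Ord_fin k n _ HXY) as [K [HK HK']].
  destruct (filter_ex _ (filter_and _ _ (near_lt 1 Rlt_0_1) (smooth_locally_quadratic n f x0 Hf)))
    as [d [Hd H]].
  assert (Hi : 0 < / d) by (apply Rinv_0_lt_compat; lra).
  exists (/ d * (K * K)). split; [apply Rmult_lt_0_compat; nra|].
  apply (near_imp2 _ _ _ HK' (filter_and _ _ (Ord_in_box n X x0 d (proj1 Hd) HX)
    (Ord_in_box n Y x0 d (proj1 Hd) HY))).
  intros h Hh H1 [H2 H3] c Hc.
  assert (0 < h ^ k) by (apply pow_lt; lra).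
  rewrite pow_add. replace (/ d * (K * K) * (h ^ k * h ^ k)) with (/ d * ((K * h ^ k) * (K * h ^ k))) by ring.
  (* The derivatives are to be taken at [X], so [X] is the base point and the sign of the expansion
     is reversed. *)
  rewrite <- Rabs_Ropp.
  replace (- (f (fun i => X i h c) - f (fun i => Y i h c) -
    fsum n (fun i => partial i f (fun j => X j h c) * (X i h c - Y i h c))))
    with (f (fun i => Y i h c) - f (fun i => X i h c) -
    fsum n (fun i => partial i f (fun j => X j h c) * (Y i h c - X i h c))).
  - apply H; [now apply H2|now apply H3|nra|]. intros i. rewrite Rabs_minus_sym. now apply H1.
  - replace (fsum n (fun i => partial i f (fun j => X j h c) * (Y i h c - X i h c)))
      with (-1 * fsum n (fun i => partial i f (fun j => X j h c) * (X i h c - Y i h c))); [ring|].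
    rewrite <- fsum_scal. apply fsum_ext. intros; ring.
Qed.

Lemma eventually_continuous_comp n (f : Vec n -> R) (X : Fin.t n -> R -> R -> R) :
  cont f -> (forall i, eventually_continuous (X i)) ->
  eventually_continuous (fun h c => f (fun i => X i h c)).
Proof.
  intros Hf HX. apply (near_imp _ _ (filter_forall_fin _ _ _ HX)). intros h _ H c Hc.
  apply (continuous_cont_comp n f (fun i => X i h)); [easy|]. intros i. now apply H.
Qed.

(** No Taylor polynomial of [f] is substituted. The derivative of the composite is a sum of
    partials, again smooth functions of [X], times [W]; this is why the induction on [N] runs over
    all [f], and integration raises the order. *)
Lemma App_comp n N (f : Vec n -> R) (X W : Fin.t n -> R -> R -> R) x0 : smooth f ->
  (forall i, eventually_derive (X i) (W i)) -> (forall i h, X i h 0 = x0 i) ->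
  (forall i, App N (W i)) -> App N (fun h c => f (fun i => X i h c)).
Proof.
  revert f. induction N as [|N IH]; intros f Hf HX H0 HW.
  - apply App_0. apply Ord0_comp with x0; [now apply smooth_cont|].
    intros i. apply Ord_derive with 0%nat (W i); [| |now apply App_Ord0 with 0%nat|lia].
    + apply (near_imp _ _ (HX i)). intros h _ H c Hc.
      replace (h * W i h c) with (minus (h * W i h c) 0) by (unfold minus, plus, opp; simpl; ring).
      apply (is_derive_minus (X i h) (fun _ => x0 i)); [now apply H|apply @is_derive_const].
    + apply Ord_ext_all with (2 := Ord_zero 1). intros. rewrite H0. ring.
  - apply App_primitive with (fun h c => fsum n (fun i => partial i f (fun j => X j h c) * W i h c)).
    + apply (near_imp _ _ (filter_forall_fin _ _ _ HX)). intros h _ H c Hc.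
      rewrite <- fsum_scal.
      rewrite (fsum_ext n _ (fun i => partial i f (fun j => X j h c) * (h * W i h c))) by (intros; ring).
      apply (is_derive_partial_comp n f (fun i => partial i f) (fun i => X i h) (fun i => h * W i h c)).
      * intros i. now apply smooth_is_partial.
      * intros i. now apply smooth_cont, smooth_partial.
      * intros i. now apply H.
    + apply (App_fsum N n (fun i h c => partial i f (fun j => X j h c) * W i h c)). intros i.
      assert (HWN : forall i, App N (W i)) by (intros; apply App_le with (S N); auto).
      apply App_mult; [|easy]. apply IH; try easy. now apply smooth_partial.
    + apply Ord_ext_all with (2 := Ord_const (f x0)). intros h c. f_equal.
      apply functional_extensionality. intros i. now rewrite H0.
Qed.

(** * Propagation of the defect *)

Lemma FTC_01 f w : eventually_derive f w -> eventually_continuous w ->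
  at_right 0 (fun h => f h 1 - f h 0 = h * RInt (w h) 0 1).
Proof.
  intros Hf Hw. apply (near_imp2 _ _ _ Hf Hw). intros h _ H1 H2.
  rewrite <- RInt_scal_R.
  - symmetry. apply is_RInt_unique. apply (is_RInt_derive (f h) (fun c => h * w h c)).
    + intros x. rewrite Rmin_left, Rmax_right by lra. intros; apply H1; lra.
    + intros x. rewrite Rmin_left, Rmax_right by lra. intros.
      apply (continuous_Rmult (fun _ => h) (w h)); [apply continuous_const|apply H2; lra].
  - apply @ex_RInt_continuous. intros x. rewrite Rmin_left, Rmax_right by lra. intros; apply H2; lra.
Qed.

Lemma eventually_derive_mult f f' g g' : eventually_derive f f' -> eventually_derive g g' ->
  eventually_derive (fun h c => f h c * g h c) (fun h c => f' h c * g h c + f h c * g' h c).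
Proof.
  intros Hf Hg. apply (near_imp2 _ _ _ Hf Hg). intros h _ H1 H2 c Hc.
  replace (h * (f' h c * g h c + f h c * g' h c))
    with (plus (mult (h * f' h c) (g h c)) (mult (f h c) (h * g' h c)))
    by (unfold plus, mult; simpl; ring).
  apply (is_derive_mult (f h) (g h)); auto. intros; apply Rmult_comm.
Qed.

Lemma eventually_derive_minus f f' g g' : eventually_derive f f' -> eventually_derive g g' ->
  eventually_derive (fun h c => f h c - g h c) (fun h c => f' h c - g' h c).
Proof.
  intros Hf Hg. apply (near_imp2 _ _ _ Hf Hg). intros h _ H1 H2 c Hc.
  replace (h * (f' h c - g' h c)) with (minus (h * f' h c) (h * g' h c))
    by (unfold minus, plus, opp; simpl; ring).
  apply (is_derive_minus (f h) (g h)); auto.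
Qed.

Lemma eventually_derive_ext f w w' :
  at_right 0 (fun h => forall c, -1 < c < 2 -> w h c = w' h c) ->
  eventually_derive f w -> eventually_derive f w'.
Proof.
  intros E H. apply (near_imp2 _ _ _ E H). intros h _ H1 H2 c Hc.
  rewrite <- H1 by easy. now apply H2.
Qed.

Lemma eventually_derive_tail w : eventually_continuous w ->
  eventually_derive (fun h c => h * RInt (w h) c 1) (fun h c => - w h c).
Proof.
  intros Hw. apply (near_imp _ _ Hw). intros h _ H c Hc.
  apply (is_derive_scal (fun c => RInt (w h) c 1) c h (- w h c)).
  apply (is_derive_RInt' (w h) (fun c => RInt (w h) c 1) c 1); [|now apply H].
  assert (Hd : 0 < Rmin (c + 1) (2 - c)) by (apply Rmin_pos; lra).
  exists (mkposreal _ Hd). intros y Hy. change (Rabs (y - c) < Rmin (c + 1) (2 - c)) in Hy.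
  apply (@RInt_correct R_CompleteNormedModule), @ex_RInt_continuous. intros z Hz. apply H.
  assert (E1 := Rmin_l (c + 1) (2 - c)). assert (E2 := Rmin_r (c + 1) (2 - c)).
  apply Rabs_def2 in Hy.
  assert (E3 : -1 < Rmin y 1) by (apply Rmin_glb_lt; lra).
  assert (E4 : Rmax y 1 < 2) by (apply Rmax_lub_lt; lra). lra.
Qed.

(** Both boundary terms vanish: the tail primitive of [w] is zero at 1 and [e] is zero at 0. The
    common factor [h] of the two derivatives cancels. *)
Lemma RInt_by_parts_tail e D w : eventually_derive e D -> eventually_continuous D ->
  eventually_continuous w -> (forall h, e h 0 = 0) ->
  at_right 0 (fun h => RInt (fun c => (h * RInt (w h) c 1) * D h c) 0 1 =
    RInt (fun c => w h c * e h c) 0 1 :> R).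
Proof.
  intros He CD Cw H0.
  assert (HV := eventually_derive_tail w Cw).
  assert (CV := eventually_continuous_derive _ _ HV).
  assert (Ce := eventually_continuous_derive _ _ He).
  assert (H := FTC_01 _ _ (eventually_derive_mult _ _ _ _ HV He)).
  assert (C1 : eventually_continuous (fun h c => - w h c * e h c)).
  { apply eventually_continuous_mult; [|easy]. now apply eventually_continuous_opp. }
  assert (C2 : eventually_continuous (fun h c => h * RInt (w h) c 1 * D h c)).
  { now apply (eventually_continuous_mult (fun h c => h * RInt (w h) c 1)). }
  assert (C3 := eventually_continuous_mult _ _ Cw Ce).
  specialize (H (eventually_continuous_plus _ _ C1 C2)).
  apply (near_imp2 _ _ _ (filter_and _ _ H C3) (filter_and _ _ C1 C2)). clear -H0.
  intros h Hh [H H3] [H1 H2].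
  rewrite RInt_point, H0, RInt_plus01 in H by (intros; first [apply H1|apply H2]; lra).
  change (@zero R_CompleteNormedModule) with 0 in H.
  assert (E : RInt (fun c => - w h c * e h c) 0 1 = -1 * RInt (fun c => w h c * e h c) 0 1 :> R).
  { rewrite <- RInt_scal_R.
    - apply RInt_ext01. intros; ring.
    - apply @ex_RInt_continuous. intros x. rewrite Rmin_left, Rmax_right by lra.
      intros; apply H3; lra. }
  rewrite E in H. apply Rmult_eq_reg_l with h; [|lra].
  rewrite Rmult_plus_distr_l in H. lra.
Qed.

(** The defects [ru], [rv] are controlled only when tested against weights of the algebra, so the
    error too is estimated in tested form until the last step. *)
Lemma duality_bound m s (eu ev ru rv : Fin.t m -> R -> R -> R)
  (A1 A2 : Fin.t m -> Fin.t m -> R -> R -> R) :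
  (forall k, eventually_derive (eu k) (fun h c => ev k h c + ru k h c)) ->
  (forall k, eventually_derive (ev k) (fun h c =>
     fsum m (fun l => A1 k l h c * eu l h c + A2 k l h c * ev l h c) + rv k h c)) ->
  (forall k h, eu k h 0 = 0) -> (forall k h, ev k h 0 = 0) ->
  (forall k l, App s (A1 k l)) -> (forall k l, App s (A2 k l)) ->
  (forall k l, eventually_continuous (A1 k l)) -> (forall k l, eventually_continuous (A2 k l)) ->
  (forall k, eventually_continuous (ru k)) -> (forall k, eventually_continuous (rv k)) ->
  (forall w k, App s w -> eventually_continuous w ->
     Ord (2 * s) (fun h _ => RInt (fun c => w h c * ru k h c) 0 1)) ->
  (forall w k, App s w -> eventually_continuous w ->
     Ord (2 * s) (fun h _ => RInt (fun c => w h c * rv k h c) 0 1)) ->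
  (forall k, Ord s (eu k)) -> (forall k, Ord s (ev k)) ->
  forall k, Ord (2 * s + 1) (fun h _ => eu k h 1) /\ Ord (2 * s + 1) (fun h _ => ev k h 1).
Proof.
  intros Du Dv U0 V0 AA1 AA2 CA1 CA2 Cru Crv Oru Orv Ou Ov.
  assert (Ceu := fun k => eventually_continuous_derive _ _ (Du k)).
  assert (Cev := fun k => eventually_continuous_derive _ _ (Dv k)).
  set (fu := fun k h c => ev k h c + ru k h c) in *.
  set (fv := fun k h c => fsum m (fun l => A1 k l h c * eu l h c + A2 k l h c * ev l h c) + rv k h c) in *.
  assert (Cfu : forall k, eventually_continuous (fu k)).
  { intros k. now apply eventually_continuous_plus. }
  assert (CA : forall k l, eventually_continuous (fun h c => A1 k l h c * eu l h c + A2 k l h c * ev l h c)).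
  { intros k l. apply eventually_continuous_plus; now apply eventually_continuous_mult. }
  assert (Cfv : forall k, eventually_continuous (fv k)).
  { intros k. apply eventually_continuous_plus; [|easy].
    apply (eventually_continuous_fsum m (fun l h c => A1 k l h c * eu l h c + A2 k l h c * ev l h c)).
    intros; apply CA. }
  (* The estimate for weights of size O(h^n): immediate for [n >= s], since the error is O(h^s), and
     wanted for [n = 0]. *)
  set (weak n := forall w, App s w -> eventually_continuous w -> Ord n w -> forall k,
    Ord (2 * s) (fun h _ => RInt (fun c => w h c * eu k h c) 0 1) /\
    Ord (2 * s) (fun h _ => RInt (fun c => w h c * ev k h c) 0 1)).
  (* The derivative of the error obeys the same estimate: the coefficients [A1], [A2] move into the
     weight, which stays in the algebra and keeps its order. *)
  assert (Hstep : forall n, weak n -> forall w, App s w -> eventually_continuous w -> Ord n w ->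
    forall k, Ord (2 * s) (fun h _ => RInt (fun c => w h c * fu k h c) 0 1) /\
    Ord (2 * s) (fun h _ => RInt (fun c => w h c * fv k h c) 0 1)).
  { intros n Hn w Aw Cw Ow k. split.
    - apply Ord_RInt_ext with (fun h c => w h c * ev k h c + w h c * ru k h c).
      { apply near_all. intros; unfold fu; ring. }
      apply Ord_RInt_plus; [now apply eventually_continuous_mult..| |now apply Oru].
      exact (proj2 (Hn w Aw Cw Ow k)).
    - apply Ord_RInt_ext with (fun h c =>
        fsum m (fun l => (w h c * A1 k l h c) * eu l h c + (w h c * A2 k l h c) * ev l h c) + w h c * rv k h c).
      { apply near_all. intros h c _. unfold fv. rewrite Rmult_plus_distr_l, <- fsum_scal. f_equal.
        apply fsum_ext. intros; ring. }
      assert (C1 : forall l, eventually_continuous (fun h c => (w h c * A1 k l h c) * eu l h c)).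
      { intros. apply eventually_continuous_mult; [now apply eventually_continuous_mult|easy]. }
      assert (C2 : forall l, eventually_continuous (fun h c => (w h c * A2 k l h c) * ev l h c)).
      { intros. apply eventually_continuous_mult; [now apply eventually_continuous_mult|easy]. }
      apply Ord_RInt_plus.
      + apply (eventually_continuous_fsum m (fun l h c =>
          (w h c * A1 k l h c) * eu l h c + (w h c * A2 k l h c) * ev l h c)).
        intros l. now apply eventually_continuous_plus.
      + now apply eventually_continuous_mult.
      + apply (Ord_RInt_fsum (2 * s) m (fun l h c =>
          (w h c * A1 k l h c) * eu l h c + (w h c * A2 k l h c) * ev l h c)).
        * intros l. now apply eventually_continuous_plus.
        * intros l. apply Ord_RInt_plus; [easy|easy|..].
          -- refine (proj1 (Hn (fun h c => w h c * A1 k l h c) _ _ _ l)).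
             ++ now apply App_mult.
             ++ now apply eventually_continuous_mult.
             ++ rewrite <- (Nat.add_0_r n). apply Ord_mult; [easy|now apply App_Ord0 with s].
          -- refine (proj2 (Hn (fun h c => w h c * A2 k l h c) _ _ _ l)).
             ++ now apply App_mult.
             ++ now apply eventually_continuous_mult.
             ++ rewrite <- (Nat.add_0_r n). apply Ord_mult; [easy|now apply App_Ord0 with s].
      + now apply Orv. }
  (* Descending induction on [n]: by parts, a weight of order [n] against the error becomes its tail
     primitive, of order [S n], against the derivative of the error. *)
  assert (Hweak : forall d n, (s <= n + d)%nat -> weak n).
  { induction d as [|d IH]; intros n Hn w Aw Cw Ow k.
    - assert (E : forall e, eventually_continuous e -> Ord s e ->
        Ord (2 * s) (fun h _ => RInt (fun c => w h c * e h c) 0 1)).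
      { intros e Ce Oe. apply (Ord_RInt (2 * s) (fun h c => w h c * e h c)).
        - now apply eventually_continuous_mult.
        - apply Ord_le with (n + s)%nat; [lia|]. now apply Ord_mult. }
      split; apply E; auto.
    - set (V := fun h c => h * RInt (w h) c 1).
      assert (DV : eventually_derive V (fun h c => - w h c)) by now apply eventually_derive_tail.
      assert (OV0 : Ord (S n) (fun h _ => V h 0)).
      { apply (Ord_step_mult n (fun h _ => RInt (w h) 0 1)). now apply Ord_RInt. }
      assert (OV : Ord (S n) V).
      { apply Ord_derive with n (fun h c => - w h c); auto. now apply Ord_opp. }
      assert (AV : App s V).
      { apply App_le with (S s); [lia|]. apply App_primitive with (fun h c => - w h c); auto.
        - now apply App_opp.
        - apply Ord_le with (S n); [lia|easy]. }
      assert (CV := eventually_continuous_derive _ _ DV).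
      destruct (Hstep (S n) (IH (S n) ltac:(lia)) V AV CV OV k) as [H1 H2].
      split.
      + apply Ord_ext with (2 := H1).
        apply (near_imp _ _ (RInt_by_parts_tail _ _ w (Du k) (Cfu k) Cw (U0 k))). intros h _ E c _. exact E.
      + apply Ord_ext with (2 := H2).
        apply (near_imp _ _ (RInt_by_parts_tail _ _ w (Dv k) (Cfv k) Cw (V0 k))). intros h _ E c _. exact E. }
  intros k.
  (* With weight 1, the value of the error at 1 is [h] times the integral of its derivative; this
     factor is the last power in [2 * s + 1]. *)
  destruct (Hstep 0%nat (Hweak s 0%nat ltac:(lia)) (fun _ _ => 1) (App_const s 1)
    (eventually_continuous_const (fun _ => 1)) (Ord_const 1) k) as [H1 H2].
  replace (2 * s + 1)%nat with (S (2 * s)) by lia.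
  assert (Hfin : forall e f, eventually_derive e f -> eventually_continuous f -> (forall h, e h 0 = 0) ->
    Ord (2 * s) (fun h _ => RInt (fun c => 1 * f h c) 0 1) -> Ord (S (2 * s)) (fun h _ => e h 1)).
  { intros e f De Cf E0 H. apply Ord_ext with (2 := Ord_step_mult _ _ H).
    apply (near_imp _ _ (FTC_01 e f De Cf)). intros h _ E c _.
    rewrite E0, Rminus_0_r in E. rewrite E. f_equal. apply RInt_ext01. intros; ring. }
  split; [exact (Hfin _ _ (Du k) (Cfu k) (U0 k) H1)|exact (Hfin _ _ (Dv k) (Cfv k) (V0 k) H2)].
Qed.

(** * Bootstrap and consistency *)

(** The velocity enters through its projection because the terms [rho i j] times [gamma j], summed
    over [j], give the [i]-th Legendre coefficient of [B] times the projected velocity. *)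
Definition projected_force m s (B : Vec m -> Fin.t m -> Fin.t m -> R) (gradU : Vec m -> Vec m)
  (uu vv : Fin.t m -> R -> R -> R) (k : Fin.t m) (h c : R) : R :=
  fsum m (fun l => B (fun i => uu i h c) k l * legendre_proj s (vv l h) c) -
  gradU (fun i => uu i h c) k.

Lemma eventually_continuous_legendre_proj s f : eventually_continuous (fun h => legendre_proj s (f h)).
Proof. apply near_all. intros h c _. apply continuous_legendre_proj. Qed.

Lemma eventually_continuous_projected_force m s B gradU uu vv k :
  (forall k l, smooth (fun x => B x k l)) -> (forall k, smooth (fun x => gradU x k)) ->
  (forall k, eventually_continuous (uu k)) ->
  eventually_continuous (projected_force m s B gradU uu vv k).
Proof.
  intros SB SU Cu. apply eventually_continuous_minus.
  - apply (eventually_continuous_fsum m (fun l h c =>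
      B (fun i => uu i h c) k l * legendre_proj s (vv l h) c)). intros l.
    apply eventually_continuous_mult.
    + apply (eventually_continuous_comp m (fun x => B x k l)); [now apply smooth_cont|easy].
    + apply (eventually_continuous_legendre_proj s (vv l)).
  - apply (eventually_continuous_comp m (fun x => gradU x k)); [now apply smooth_cont|easy].
Qed.

Lemma method_App m s B gradU (q0 p0 : Vec m) uu vv :
  (forall k l, smooth (fun x => B x k l)) -> (forall k, smooth (fun x => gradU x k)) ->
  (forall k, eventually_derive (uu k) (fun h => legendre_proj s (vv k h))) ->
  (forall k, eventually_derive (vv k) (fun h => legendre_proj s (projected_force m s B gradU uu vv k h))) ->
  (forall k h, uu k h 0 = q0 k) -> (forall k h, vv k h 0 = p0 k) ->
  (forall k, Ord 0 (vv k)) -> forall n,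
  (forall k, App n (uu k)) /\ (forall k, App n (vv k)) /\
  (forall k l, App n (fun h c => B (fun i => uu i h c) k l)) /\
  (forall k l j, App n (fun h c => partial j (fun x => B x k l) (fun i => uu i h c))) /\
  (forall k j, App n (fun h c => partial j (fun x => gradU x k) (fun i => uu i h c))) /\
  (forall k, App n (projected_force m s B gradU uu vv k)).
Proof.
  intros SB SU Du Dv U0 V0 Ov.
  assert (Cu := fun k => eventually_continuous_derive _ _ (Du k)).
  assert (Cv := fun k => eventually_continuous_derive _ _ (Dv k)).
  assert (Cf := fun k => eventually_continuous_projected_force m s B gradU uu vv k SB SU Cu).
  assert (Hcomp : forall n, (forall k, App n (vv k)) -> forall f, smooth f ->
    App n (fun h c => f (fun i => uu i h c))).
  { intros n Hv f Sf. apply (App_comp m n f uu (fun k h => legendre_proj s (vv k h)) q0); auto.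
    intros i. now apply App_legendre_proj. }
  assert (Hf : forall n, (forall k, App n (vv k)) -> forall k, App n (projected_force m s B gradU uu vv k)).
  { intros n Hv k. apply App_minus.
    - apply (App_fsum n m (fun l h c =>
        B (fun i => uu i h c) k l * legendre_proj s (vv l h) c)). intros l.
      apply App_mult; [now apply (Hcomp n Hv (fun x => B x k l))|].
      now apply (App_legendre_proj s n (vv l)).
    - now apply (Hcomp n Hv (fun x => gradU x k)). }
  (* Functions of [uu] and the force inherit the order of [vv]; only integrating the equation for
     [vv] raises it. *)
  assert (Hv : forall n k, App n (vv k)).
  { induction n as [|n IH]; intros k; [now apply App_0|].
    apply App_primitive with (fun h => legendre_proj s (projected_force m s B gradU uu vv k h)); auto.
    - apply App_legendre_proj; auto.
    - apply Ord_ext_all with (2 := Ord_const (p0 k)). intros; now rewrite V0. }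
  intros n. repeat split; auto.
  - intros k. apply App_le with (S n); [lia|].
    apply App_primitive with (fun h => legendre_proj s (vv k h)); auto.
    + now apply App_legendre_proj.
    + apply Ord_ext_all with (2 := Ord_const (q0 k)). intros; now rewrite U0.
  - intros k l. now apply (Hcomp n (Hv n) (fun x => B x k l)).
  - intros k l j. apply (Hcomp n (Hv n)). now apply smooth_partial.
  - intros k j. apply (Hcomp n (Hv n)). now apply smooth_partial.
Qed.

Lemma fsum_exchange n m (f : Fin.t n -> Fin.t m -> R) :
  fsum n (fun i => fsum m (fun j => f i j)) = fsum m (fun j => fsum n (fun i => f i j)).
Proof.
  induction n as [|n IH]; simpl.
  - induction m as [|m IH]; simpl; [easy|].
    rewrite <- (IH (fun i j => f i (Fin.FS j))). ring.
  - now rewrite IH, fsum_plus.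
Qed.

Lemma fsum_minus n f g : fsum n (fun i => f i - g i) = fsum n f - fsum n g.
Proof. induction n as [|n IH]; simpl; [ring|rewrite IH; ring]. Qed.

Lemma Ord_close f w x0 : eventually_derive f w -> Ord 0 w -> (forall h, f h 0 = x0) ->
  Ord 1 (fun h c => f h c - x0).
Proof.
  intros Hd Hw H0. apply Ord_derive with 0%nat w; [| |easy|lia].
  - apply (near_imp _ _ Hd). intros h _ H c Hc.
    replace (h * w h c) with (minus (h * w h c) 0) by (unfold minus, plus, opp; simpl; ring).
    apply (is_derive_minus (f h) (fun _ => x0)); [now apply H|apply @is_derive_const].
  - apply Ord_ext_all with (2 := Ord_zero 1). intros. rewrite H0. ring.
Qed.

Lemma method_order m s (B : Vec m -> Fin.t m -> Fin.t m -> R) (gradU : Vec m -> Vec m)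
  (q0 p0 : Vec m) (uu vv qq pp : Fin.t m -> R -> R -> R) :
  (forall k l, smooth (fun x => B x k l)) -> (forall k, smooth (fun x => gradU x k)) ->
  (forall k, eventually_derive (uu k) (fun h => legendre_proj s (vv k h))) ->
  (forall k, eventually_derive (vv k) (fun h => legendre_proj s (projected_force m s B gradU uu vv k h))) ->
  (forall k h, uu k h 0 = q0 k) -> (forall k h, vv k h 0 = p0 k) ->
  (forall k, Ord 0 (vv k)) ->
  (forall k, eventually_derive (qq k) (pp k)) ->
  (forall k, eventually_derive (pp k) (fun h c =>
     fsum m (fun l => B (fun i => qq i h c) k l * pp l h c) - gradU (fun i => qq i h c) k)) ->
  (forall k h, qq k h 0 = q0 k) -> (forall k h, pp k h 0 = p0 k) ->
  (forall k, Ord 0 (pp k)) ->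
  forall k, Ord (2 * s + 1) (fun h _ => uu k h 1 - qq k h 1) /\
            Ord (2 * s + 1) (fun h _ => vv k h 1 - pp k h 1).
Proof.
  intros SB SU Du Dv U0 V0 Ov Dq Dp Q0 P0 Op.
  destruct (method_App m s B gradU q0 p0 uu vv SB SU Du Dv U0 V0 Ov s)
    as [Au [Av [AB [AdB [AdU Ag]]]]].
  assert (Cu := fun k => eventually_continuous_derive _ _ (Du k)).
  assert (Cv := fun k => eventually_continuous_derive _ _ (Dv k)).
  assert (Cq := fun k => eventually_continuous_derive _ _ (Dq k)).
  assert (Cp := fun k => eventually_continuous_derive _ _ (Dp k)).
  set (g := projected_force m s B gradU uu vv) in *.
  assert (Cg : forall k, eventually_continuous (g k)).
  { intros k. now apply eventually_continuous_projected_force. }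
  assert (Xu : forall k, Ord 1 (fun h c => uu k h c - q0 k)).
  { intros k. apply Ord_close with (1 := Du k); [|easy]. now apply (Ord_legendre_proj s 0 (vv k)). }
  assert (Xq : forall k, Ord 1 (fun h c => qq k h c - q0 k)).
  { intros k. now apply Ord_close with (1 := Dq k). }
  set (eu := fun k h c => uu k h c - qq k h c).
  set (ev := fun k h c => vv k h c - pp k h c).
  set (ru := fun k h c => legendre_proj s (vv k h) c - vv k h c).
  set (rg := fun k h c => legendre_proj s (g k h) c - g k h c).
  set (Bu := fun k l h c => B (fun i => uu i h c) k l).
  set (Bq := fun k l h c => B (fun i => qq i h c) k l).
  set (Gu := fun k h c => gradU (fun i => uu i h c) k).
  set (Gq := fun k h c => gradU (fun i => qq i h c) k).
  set (dB := fun k l j h c => partial j (fun x => B x k l) (fun i => uu i h c)).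
  set (dG := fun k j h c => partial j (fun x => gradU x k) (fun i => uu i h c)).
  assert (CBu : forall k l, eventually_continuous (Bu k l)).
  { intros k l. apply (eventually_continuous_comp m (fun x => B x k l)); [now apply smooth_cont|easy]. }
  assert (CBq : forall k l, eventually_continuous (Bq k l)).
  { intros k l. apply (eventually_continuous_comp m (fun x => B x k l)); [now apply smooth_cont|easy]. }
  assert (CGu : forall k, eventually_continuous (Gu k)).
  { intros k. apply (eventually_continuous_comp m (fun x => gradU x k)); [now apply smooth_cont|easy]. }
  assert (CGq : forall k, eventually_continuous (Gq k)).
  { intros k. apply (eventually_continuous_comp m (fun x => gradU x k)); [now apply smooth_cont|easy]. }
  assert (CdB : forall k l j, eventually_continuous (dB k l j)).
  { intros k l j. apply (eventually_continuous_comp m); [now apply smooth_cont, smooth_partial|easy]. }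
  assert (CdG : forall k j, eventually_continuous (dG k j)).
  { intros k j. apply (eventually_continuous_comp m); [now apply smooth_cont, smooth_partial|easy]. }
  assert (Ceu : forall k, eventually_continuous (eu k)) by (intros; now apply eventually_continuous_minus).
  assert (Cev : forall k, eventually_continuous (ev k)) by (intros; now apply eventually_continuous_minus).
  assert (Cru : forall k, eventually_continuous (ru k)).
  { intros. apply eventually_continuous_minus; [|easy]. apply (eventually_continuous_legendre_proj s (vv k)). }
  assert (Crg : forall k, eventually_continuous (rg k)).
  { intros. apply eventually_continuous_minus; [|easy]. apply (eventually_continuous_legendre_proj s (g k)). }
  assert (Oru : forall k, Ord s (ru k)) by (intros; now apply Ord_legendre_error).
  assert (Org : forall k, Ord s (rg k)) by (intros; now apply Ord_legendre_error).
  assert (OBu : forall k l, Ord 0 (Bu k l)) by (intros; now apply App_Ord0 with s, AB).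
  assert (OBq : forall k l, Ord 0 (Bq k l)).
  { intros k l. apply (Ord0_comp m (fun x => B x k l) qq q0); [now apply smooth_cont|easy]. }
  assert (Deu : forall k, eventually_derive (eu k) (fun h c => ev k h c + ru k h c)).
  { intros k. apply eventually_derive_ext with (2 := eventually_derive_minus _ _ _ _ (Du k) (Dq k)).
    apply near_all. intros h c _. unfold ev, ru. ring. }
  (* Unlinearised form, enough for the a priori bound. The term with [ru] arises because the method
     sees the projected velocity. *)
  assert (Dev : forall k, eventually_derive (ev k) (fun h c =>
     rg k h c + fsum m (fun l => Bu k l h c * ru l h c) +
     (fsum m (fun l => Bu k l h c * vv l h c - Bq k l h c * pp l h c) - (Gu k h c - Gq k h c)))).
  { intros k. apply eventually_derive_ext with (2 := eventually_derive_minus _ _ _ _ (Dv k) (Dp k)).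
    apply near_all. intros h c _. unfold rg, ru.
    rewrite fsum_minus.
    rewrite (fsum_ext m (fun l => Bu k l h c * (legendre_proj s (vv l h) c - vv l h c))
      (fun l => Bu k l h c * legendre_proj s (vv l h) c - Bu k l h c * vv l h c)) by (intros; ring).
    rewrite fsum_minus.
    assert (E : g k h c = fsum m (fun l => Bu k l h c * legendre_proj s (vv l h) c) - Gu k h c) by easy.
    rewrite E. unfold Bq, Gq. ring. }
  assert (EU0 : forall k h, eu k h 0 = 0) by (intros; unfold eu; rewrite U0, Q0; ring).
  assert (EV0 : forall k h, ev k h 0 = 0) by (intros; unfold ev; rewrite V0, P0; ring).
  (* Each round gains one order through [Ord_derive]; the order [s] of the defects is where this
     stops. *)
  assert (Oe : forall n, (n <= s)%nat -> (forall k, Ord n (eu k)) /\ (forall k, Ord n (ev k))).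
  { induction n as [|n IH]; intros Hn.
    - split; intros k; apply Ord_minus; auto; try (now apply App_Ord0 with s).
      apply Ord_ext_all with (fun h c => (qq k h c - q0 k) + q0 k); [intros; ring|].
      apply Ord_plus; [|apply Ord_const]. apply Ord_le with 1%nat; [lia|easy].
    - destruct IH as [IHu IHv]; [lia|].
      assert (Oru' : forall k, Ord n (ru k)) by (intros; apply Ord_le with s; [lia|easy]).
      assert (Org' : forall k, Ord n (rg k)) by (intros; apply Ord_le with s; [lia|easy]).
      split; intros k.
      + apply Ord_derive with (1 := Deu k) (k := n); [| |lia].
        * apply Ord_ext_all with (2 := Ord_zero (S n)). intros; now rewrite EU0.
        * now apply Ord_plus.
      + apply Ord_derive with (1 := Dev k) (k := n); [| |lia].
        * apply Ord_ext_all with (2 := Ord_zero (S n)). intros; now rewrite EV0.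
        * apply Ord_plus; [apply Ord_plus|apply Ord_minus].
          -- easy.
          -- apply (Ord_fsum n m (fun l h c => Bu k l h c * ru l h c)). intros l.
             now apply (Ord_mult 0 n).
          -- apply (Ord_fsum n m (fun l h c => Bu k l h c * vv l h c - Bq k l h c * pp l h c)). intros l.
             apply Ord_ext_all with (fun h c => vv l h c * (Bu k l h c - Bq k l h c) + Bq k l h c * ev l h c).
             { intros; unfold ev; ring. }
             apply Ord_plus; apply (Ord_mult 0 n); auto.
             now apply (Ord_Lipschitz m n (fun x => B x k l) uu qq q0).
          -- now apply (Ord_Lipschitz m n (fun x => gradU x k) uu qq q0). }
  destruct (Oe s (le_n s)) as [Oeu Oev].
  (* Derivative in the position of the exact, unprojected force, taken at the numerical solution. *)
  set (A1 := fun k l h c => fsum m (fun j => dB k j l h c * vv j h c) - dG k l h c).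
  (* Quadratic remainder, from [Bu vv - Bq pp = Bu ev + (Bu - Bq) vv - (Bu - Bq) ev]: two Taylor
     remainders and a product of two quantities of order [s]. *)
  set (kappa := fun k h c =>
    fsum m (fun j => (Bu k j h c - Bq k j h c - fsum m (fun l => dB k j l h c * eu l h c)) * vv j h c
       - (Bu k j h c - Bq k j h c) * ev j h c) -
    (Gu k h c - Gq k h c - fsum m (fun l => dG k l h c * eu l h c))).
  assert (CA1 : forall k l, eventually_continuous (A1 k l)).
  { intros k l. apply eventually_continuous_minus; [|easy].
    apply (eventually_continuous_fsum m (fun j h c => dB k j l h c * vv j h c)).
    intros. now apply eventually_continuous_mult. }
  assert (AA1 : forall k l, App s (A1 k l)).
  { intros k l. apply App_minus; [|apply AdU].
    apply (App_fsum s m (fun j h c => dB k j l h c * vv j h c)).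
    intros. apply App_mult; [apply AdB|easy]. }
  assert (Ckappa : forall k, eventually_continuous (kappa k)).
  { intros k. apply eventually_continuous_minus.
    - apply (eventually_continuous_fsum m (fun j h c =>
        (Bu k j h c - Bq k j h c - fsum m (fun l => dB k j l h c * eu l h c)) * vv j h c
         - (Bu k j h c - Bq k j h c) * ev j h c)). intros j.
      apply eventually_continuous_minus; apply eventually_continuous_mult; auto.
      2: now apply eventually_continuous_minus.
      apply eventually_continuous_minus; [now apply eventually_continuous_minus|].
      apply (eventually_continuous_fsum m (fun l h c => dB k j l h c * eu l h c)).
      intros; now apply eventually_continuous_mult.
    - apply eventually_continuous_minus; [now apply eventually_continuous_minus|].
      apply (eventually_continuous_fsum m (fun l h c => dG k l h c * eu l h c)).
      intros; now apply eventually_continuous_mult. }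
  assert (Okappa : forall k, Ord (s + s) (kappa k)).
  { intros k. apply Ord_minus.
    - apply (Ord_fsum (s + s) m (fun j h c =>
        (Bu k j h c - Bq k j h c - fsum m (fun l => dB k j l h c * eu l h c)) * vv j h c
         - (Bu k j h c - Bq k j h c) * ev j h c)). intros j.
      apply Ord_minus.
      + rewrite <- (Nat.add_0_r (s + s)). apply Ord_mult; [|easy].
        now apply (Ord_quadratic m s (fun x => B x k j) uu qq q0).
      + apply Ord_mult; [|easy]. now apply (Ord_Lipschitz m s (fun x => B x k j) uu qq q0).
    - now apply (Ord_quadratic m s (fun x => gradU x k) uu qq q0). }
  set (rv := fun k h c => rg k h c + fsum m (fun l => Bu k l h c * ru l h c) + kappa k h c).
  assert (CBr : forall k, eventually_continuous (fun h c => fsum m (fun l => Bu k l h c * ru l h c))).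
  { intros k. apply (eventually_continuous_fsum m (fun l h c => Bu k l h c * ru l h c)).
    intros; now apply eventually_continuous_mult. }
  apply (duality_bound m s eu ev ru rv A1 Bu); auto.
  - intros k. apply eventually_derive_ext with (2 := Dev k). apply near_all. intros h c _.
    unfold rv, kappa, A1. rewrite !fsum_plus, !fsum_minus.
    rewrite (fsum_ext m (fun l => (fsum m (fun j => dB k j l h c * vv j h c) - dG k l h c) * eu l h c)
      (fun l => fsum m (fun j => dB k j l h c * eu l h c * vv j h c) - dG k l h c * eu l h c)).
    2:{ intros l. rewrite Rmult_minus_distr_r, (Rmult_comm (fsum m _)), <- fsum_scal. f_equal.
        apply fsum_ext. intros; ring. }
    rewrite fsum_minus, fsum_exchange.
    rewrite (fsum_ext m (fun j => (Bu k j h c - Bq k j h c - fsum m (fun l => dB k j l h c * eu l h c)) * vv j h c)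
      (fun j => Bu k j h c * vv j h c - Bq k j h c * vv j h c - fsum m (fun l => dB k j l h c * eu l h c * vv j h c))).
    2:{ intros j. rewrite (fsum_ext m (fun l => dB k j l h c * eu l h c * vv j h c)
          (fun l => vv j h c * (dB k j l h c * eu l h c))) by (intros; ring).
        rewrite fsum_scal. ring. }
    rewrite (fsum_ext m (fun j => (Bu k j h c - Bq k j h c) * ev j h c)
      (fun j => Bu k j h c * ev j h c - (Bq k j h c * vv j h c - Bq k j h c * pp j h c)))
      by (intros; unfold ev; ring).
    rewrite !fsum_minus. ring.
  - intros k. apply eventually_continuous_plus; [|easy]. now apply eventually_continuous_plus.
  - intros w k Aw Cw. now apply Ord_RInt_legendre_error.
  - intros w k Aw Cw.
    (* [Bu] joins the weight, so superconvergence applies to [ru] as well as to [rg]; [kappa] is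
       O(h^(2s)) pointwise. *)
    apply Ord_RInt_ext with (fun h c => (w h c * rg k h c +
       fsum m (fun l => (w h c * Bu k l h c) * ru l h c)) + w h c * kappa k h c).
    { apply near_all. intros h c _. unfold rv. rewrite !Rmult_plus_distr_l. f_equal. f_equal.
      rewrite <- fsum_scal. apply fsum_ext. intros; ring. }
    assert (C1 : eventually_continuous (fun h c => fsum m (fun l => (w h c * Bu k l h c) * ru l h c))).
    { apply (eventually_continuous_fsum m (fun l h c => (w h c * Bu k l h c) * ru l h c)).
      intros l. apply eventually_continuous_mult; [now apply eventually_continuous_mult|easy]. }
    assert (C2 : eventually_continuous (fun h c => w h c * rg k h c)) by now apply eventually_continuous_mult.
    assert (C3 : eventually_continuous (fun h c => w h c * kappa k h c)) by now apply eventually_continuous_mult.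
    apply Ord_RInt_plus; [now apply eventually_continuous_plus|easy|apply Ord_RInt_plus; [easy|easy|..]|].
    + now apply Ord_RInt_legendre_error.
    + apply (Ord_RInt_fsum (2 * s) m (fun l h c => (w h c * Bu k l h c) * ru l h c)).
      * intros l. apply eventually_continuous_mult; [now apply eventually_continuous_mult|easy].
      * intros l. apply (Ord_RInt_legendre_error s (fun h c => w h c * Bu k l h c)); auto.
        -- now apply eventually_continuous_mult.
        -- apply App_mult; [easy|apply AB].
    + apply (Ord_RInt (2 * s) (fun h c => w h c * kappa k h c)); [easy|].
      replace (2 * s)%nat with (0 + (s + s))%nat by lia.
      apply Ord_mult; [now apply App_Ord0 with s|easy].
Qed.

(** * From the integral equations of the method to its differential form *)

Lemma integ_eq_RInt (f g : R -> R) :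
  (forall x, 0 <= x <= 1 -> f x = g x) -> (forall x, continuous g x) ->
  integ f 0 1 = RInt g 0 1.
Proof.
  intros E Hg. rewrite integ_RInt; [now apply RInt_ext01|].
  apply ex_RInt_ext with g.
  - intros x. rewrite Rmin_left, Rmax_right by lra. intros; rewrite E; [easy|lra].
  - now apply ex_RInt_cont.
Qed.

(** Continuity at the points (c, 0), a compact segment outside the range of step sizes, bounds the
    family uniformly in [c] for small [h]; this starts the bootstrap. *)
Lemma cont_pair2_Ord (F : Vec 2 -> R) : cont F -> Ord 0 (fun h c => F (pair2 c h)).
Proof.
  intros HF.
  (* The cap on [d] makes the Lebesgue number of the cover bound [F] on the compact segment. *)
  assert (Hd : forall t, exists d : posreal, d <= / (Rabs (F (pair2 t 0)) + 1) /\
    forall x h, Rabs (x - t) < d -> Rabs h < d -> Rabs (F (pair2 x h) - F (pair2 t 0)) < 1).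
  { intros t. destruct (HF (pair2 t 0) 1 Rlt_0_1) as [d [Hd H]].
    assert (Hp := Rabs_pos (F (pair2 t 0))).
    assert (Hq : 0 < / (Rabs (F (pair2 t 0)) + 1)) by (apply Rinv_0_lt_compat; lra).
    exists (mkposreal _ (Rmin_pos _ _ Hd Hq)). simpl. split; [apply Rmin_r|].
    intros x h Hx Hh. apply H.
    assert (Hm := Rmin_l d (/ (Rabs (F (pair2 t 0)) + 1))).
    intros i. unfold pair2. pattern i; apply Fin.caseS'.
    - lra.
    - intros p. rewrite Rminus_0_r. lra. }
  set (delta t := proj1_sig (constructive_indefinite_description _ (Hd t))).
  assert (Hdelta : forall t, delta t <= / (Rabs (F (pair2 t 0)) + 1) /\
    forall x h, Rabs (x - t) < delta t -> Rabs h < delta t ->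
      Rabs (F (pair2 x h) - F (pair2 t 0)) < 1).
  { intros t. unfold delta. apply (proj2_sig (constructive_indefinite_description _ (Hd t))). }
  clearbody delta.
  destruct (compactness_value_1d 0 1 delta) as [d Hcov].
  assert (Hid : 0 < / d) by (apply Rinv_0_lt_compat, cond_pos).
  exists (/ d + 1). split; [lra|].
  apply (near_imp _ _ (near_lt d (cond_pos d))). intros h _ Hh c Hc. simpl. rewrite Rmult_1_r.
  (* [compactness_value_1d] provides the covering point under a double negation, hence the argument
     by contradiction. *)
  apply Rnot_lt_le. intros Hlt. apply (Hcov c Hc). intros [t [Ht [Hct Hdt]]].
  destruct (Hdelta t) as [H1 H2].
  assert (H3 := H2 c h Hct ltac:(rewrite Rabs_pos_eq; lra)).
  assert (H4 : Rabs (F (pair2 t 0)) + 1 <= / d).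
  { rewrite <- (Rinv_inv (Rabs (F (pair2 t 0)) + 1)). apply Rinv_le_contravar; [apply cond_pos|lra]. }
  assert (H5 := Rabs_triang (F (pair2 c h) - F (pair2 t 0)) (F (pair2 t 0))).
  replace (F (pair2 c h) - F (pair2 t 0) + F (pair2 t 0)) with (F (pair2 c h)) in H5 by ring.
  lra.
Qed.

Lemma is_derive_RInt_P_nsum s (a : nat -> R) b h c :
  is_derive (fun c => b + h * nsum s (fun i => RInt (P i) 0 c * a i)) c
    (h * nsum s (fun i => P i c * a i)).
Proof.
  replace (h * nsum s (fun i => P i c * a i)) with (plus 0 (h * nsum s (fun i => P i c * a i)))
    by (unfold plus; simpl; ring).
  apply (is_derive_plus (fun _ => b) (fun c => h * nsum s (fun i => RInt (P i) 0 c * a i)));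
    [apply @is_derive_const|].
  apply (is_derive_scal (fun c => nsum s (fun i => RInt (P i) 0 c * a i))).
  apply (is_derive_nsum s (fun i c => RInt (P i) 0 c * a i)). intros i _.
  apply is_derive_ext with (fun c => a i * RInt (P i) 0 c); [intros; apply Rmult_comm|].
  rewrite Rmult_comm. apply (is_derive_scal (fun c => RInt (P i) 0 c)).
  apply (is_derive_RInt (P i) (fun c => RInt (P i) 0 c) 0); [|apply continuous_P].
  apply filter_forall. intros y. apply (@RInt_correct R_CompleteNormedModule).
  apply ex_RInt_cont. apply continuous_P.
Qed.

Theorem theorem2
  (m : nat) (U : Vec m -> R) (gradU : Vec m -> Vec m)
  (B : Vec m -> Fin.t m -> Fin.t m -> R)
  (s : nat) (q0 p0 : Vec m)
  (q p : R -> Vec m) (T : R)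
  (u v : R -> R -> Vec m) (h0 : R) :
  (* U and B are C^infinity, gradU is the gradient of U, B is skew *)
  smooth U ->
  (forall i, is_partial U i (fun x => gradU x i)) ->
  (forall k l, smooth (fun x => B x k l)) ->
  (forall x k l, B x l k = - B x k l) ->
  (1 <= s)%nat ->
  (* (q,p) is the exact solution on (-T,T) *)
  0 < T ->
  (forall k, q 0 k = q0 k) -> (forall k, p 0 k = p0 k) ->
  (forall t k, - T < t < T ->
     derivable_pt_lim (fun t => q t k) t (p t k) /\
     derivable_pt_lim (fun t => p t k) t
       (fsum m (fun l => B (q t) k l * p t l) - gradU (q t) k)) ->
  (* for 0 < h < h0: u_h, v_h are polynomials of degree <= s *)
  0 < h0 ->
  (forall h, 0 < h < h0 ->
     exists a b : nat -> Vec m, forall tau k,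
       u h tau k = nsum (S s) (fun n => a n k * tau ^ n) /\
       v h tau k = nsum (S s) (fun n => b n k * tau ^ n)) ->
  (* they satisfy the collocation-type equations for all c in [0,1] *)
  (forall h c k, 0 < h < h0 -> 0 <= c <= 1 ->
     u h (c * h) k =
       q0 k + h * nsum s (fun i => integ (P i) 0 c * gamma h (v h) i k) /\
     v h (c * h) k =
       p0 k + h * nsum s (fun i => integ (P i) 0 c *
         (- eta gradU h (u h) i k
          + nsum s (fun j => fsum m (fun l =>
               rho B h (u h) i j k l * gamma h (v h) j l))))) ->
  (* (c,h) |-> u_h(ch), v_h(ch) is smooth *)
  (exists F G : Vec 2 -> Vec m,
     (forall k, smooth (fun x => F x k)) /\ (forall k, smooth (fun x => G x k)) /\
     forall c h k, 0 <= c <= 1 -> 0 < h < h0 ->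
       u h (c * h) k = F (pair2 c h) k /\ v h (c * h) k = G (pair2 c h) k) ->
  (* conclusion: order 2s *)
  exists Cst h1, 0 < h1 /\
    forall h k, 0 < h < h1 ->
      Rabs (u h h k - q h k) <= Cst * h ^ (2 * s + 1) /\
      Rabs (v h h k - p h k) <= Cst * h ^ (2 * s + 1).
Proof.
  intros SU DU SB _ _ HT Hq0 Hp0 Hode Hh0 _ Hcol [F [G [_ [SG HFG]]]].
  assert (SdU : forall k, smooth (fun x => gradU x k)).
  { intros k. rewrite (is_partial_unique _ _ _ _ (DU k)). now apply smooth_partial. }
  set (qq := fun k h c => q (c * h) k). set (pp := fun k h c => p (c * h) k).
  (* The right-hand sides of the method's equations, read as functions of every real [c]: they agree
     with [u] and [v] on [0,1] and are differentiable on the larger interval. *)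
  set (uu := fun k h c => q0 k + h * nsum s (fun i => RInt (P i) 0 c * gamma h (v h) i k)).
  set (b := fun k h i => - eta gradU h (u h) i k
          + nsum s (fun j => fsum m (fun l =>
               rho B h (u h) i j k l * gamma h (v h) j l))).
  set (vv := fun k h c => p0 k + h * nsum s (fun i => RInt (P i) 0 c * b k h i)).
  assert (Cu : forall k h c, continuous (uu k h) c).
  { intros k h c. apply @ex_derive_continuous. eexists. apply is_derive_RInt_P_nsum. }
  assert (Cv : forall k h c, continuous (vv k h) c).
  { intros k h c. apply @ex_derive_continuous. eexists. apply is_derive_RInt_P_nsum. }
  assert (EP : forall i c, integ (P i) 0 c = RInt (P i) 0 c).
  { intros i c. apply integ_RInt, ex_RInt_cont, continuous_P. }
  assert (Eu : forall h c k, 0 < h < h0 -> 0 <= c <= 1 -> u h (c * h) k = uu k h c).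
  { intros h c k Hh Hc. rewrite (proj1 (Hcol h c k Hh Hc)). unfold uu. f_equal. f_equal.
    apply nsum_ext. intros. now rewrite EP. }
  assert (Ev : forall h c k, 0 < h < h0 -> 0 <= c <= 1 -> v h (c * h) k = vv k h c).
  { intros h c k Hh Hc. rewrite (proj2 (Hcol h c k Hh Hc)). unfold vv. f_equal. f_equal.
    apply nsum_ext. intros. now rewrite EP. }
  assert (Euv : forall h c, 0 < h < h0 -> 0 <= c <= 1 -> u h (c * h) = fun i => uu i h c).
  { intros. apply functional_extensionality. intros; now apply Eu. }
  assert (Eg : forall h i k, 0 < h < h0 ->
    gamma h (v h) i k = RInt (fun y => P i y * vv k h y) 0 1).
  { intros h i k Hh. apply integ_eq_RInt.
    - intros x Hx. now rewrite Ev.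
    - intros x. apply continuous_Rmult; [apply continuous_P|apply Cv]. }
  assert (CB : forall k l h c, continuous (fun c => B (fun i => uu i h c) k l) c).
  { intros k l h c. apply (continuous_cont_comp m (fun x => B x k l) (fun i => uu i h));
      [now apply smooth_cont|auto]. }
  assert (CU : forall k h c, continuous (fun c => gradU (fun i => uu i h c) k) c).
  { intros k h c. apply (continuous_cont_comp m (fun x => gradU x k) (fun i => uu i h));
      [now apply smooth_cont|auto]. }
  (* Moving the sum over [j] under the integral turns [P j] times [gamma j] into the projected
     velocity, so the bracket of the method is a Legendre coefficient of the projected force. *)
  assert (Eb : forall h i k, 0 < h < h0 ->
    b k h i = RInt (fun y => P i y * projected_force m s B gradU uu vv k h y) 0 1).
  { intros h i k Hh. unfold b.
    assert (E1 : eta gradU h (u h) i k = RInt (fun y => P i y * gradU (fun i => uu i h y) k) 0 1).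
    { apply integ_eq_RInt.
      - intros x Hx. now rewrite Euv.
      - intros x. apply continuous_Rmult; [apply continuous_P|apply CU]. }
    assert (E2 : forall j l, rho B h (u h) i j k l =
      RInt (fun y => P i y * P j y * B (fun i => uu i h y) k l) 0 1).
    { intros j l. apply integ_eq_RInt.
      - intros x Hx. now rewrite Euv.
      - intros x. apply continuous_Rmult; [apply continuous_Rmult; apply continuous_P|apply CB]. }
    rewrite E1, nsum_fsum_exchange.
    assert (X1 : ex_RInt (fun y => P i y * gradU (fun i => uu i h y) k) 0 1).
    { apply ex_RInt_cont. intros. apply continuous_Rmult; [apply continuous_P|apply CU]. }
    assert (X2 : forall l j, ex_RInt (fun y => gamma h (v h) j l * (P i y * P j y * B (fun i => uu i h y) k l)) 0 1).
    { intros. apply ex_RInt_scal_R, ex_RInt_cont. intros.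
      apply continuous_Rmult; [apply continuous_Rmult; apply continuous_P|apply CB]. }
    assert (X3 := fun l => ex_RInt_nsum s (fun j y =>
      gamma h (v h) j l * (P i y * P j y * B (fun i => uu i h y) k l)) 0 1 (fun j _ => X2 l j)).
    assert (X4 := ex_RInt_fsum m (fun l y => nsum s (fun j =>
      gamma h (v h) j l * (P i y * P j y * B (fun i => uu i h y) k l))) 0 1 (fun l => proj1 (X3 l))).
    rewrite (fsum_ext m _ (fun l => RInt (fun y => nsum s (fun j =>
      gamma h (v h) j l * (P i y * P j y * B (fun i => uu i h y) k l))) 0 1)).
    2:{ intros l. rewrite (proj2 (X3 l)). apply nsum_ext. intros j _.
        rewrite E2, RInt_scal_R; [apply Rmult_comm|].
        apply ex_RInt_cont. intros.
        apply continuous_Rmult; [apply continuous_Rmult; apply continuous_P|apply CB]. }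
    rewrite <- (proj2 X4).
    transitivity (RInt (fun y => -1 * (P i y * gradU (fun i => uu i h y) k) + fsum m (fun l => nsum s (fun j =>
      gamma h (v h) j l * (P i y * P j y * B (fun i => uu i h y) k l)))) 0 1).
    - rewrite (RInt_plus (fun y => -1 * (P i y * gradU (fun i => uu i h y) k)));
        [|now apply ex_RInt_scal_R|apply X4].
      rewrite RInt_scal_R by easy. unfold plus; simpl. ring.
    - apply RInt_ext01. intros y _. unfold projected_force.
      rewrite Rmult_minus_distr_l, <- fsum_scal.
      rewrite (fsum_ext m _ (fun l => P i y * (B (fun i0 => uu i0 h y) k l * legendre_proj s (vv l h) y))).
      + ring.
      + intros l. unfold legendre_proj. rewrite <- !nsum_scal. apply nsum_ext. intros j _.
        rewrite <- Eg by easy. ring. }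
  assert (Du : forall k, eventually_derive (uu k) (fun h => legendre_proj s (vv k h))).
  { intros k. apply (near_imp _ _ (near_lt h0 Hh0)). intros h _ Hh c _.
    replace (legendre_proj s (vv k h) c) with (nsum s (fun i => P i c * gamma h (v h) i k)).
    - apply is_derive_RInt_P_nsum.
    - apply nsum_ext. intros. now rewrite Eg. }
  assert (Dv : forall k, eventually_derive (vv k)
    (fun h => legendre_proj s (projected_force m s B gradU uu vv k h))).
  { intros k. apply (near_imp _ _ (near_lt h0 Hh0)). intros h _ Hh c _.
    replace (legendre_proj s (projected_force m s B gradU uu vv k h) c)
      with (nsum s (fun i => P i c * b k h i)).
    - apply is_derive_RInt_P_nsum.
    - apply nsum_ext. intros. now rewrite Eb. }
  assert (Z : forall (a : nat -> R), nsum s (fun i => RInt (P i) 0 0 * a i) = 0).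
  { intros a. apply nsum_zero. intros i _. rewrite RInt_point. apply Rmult_0_l. }
  assert (Ov : forall k, Ord 0 (vv k)).
  { intros k. apply Ord_ext with (2 := cont_pair2_Ord _ (smooth_cont _ _ (SG k))).
    apply (near_imp _ _ (near_lt h0 Hh0)). intros h _ Hh c Hc.
    rewrite <- Ev by easy. symmetry. now apply HFG. }
  (* The bound [T / 2] matches the right end 2 of the interval of [c]. *)
  assert (HcT : forall h c, 0 < h < T / 2 -> -1 < c < 2 -> - T < c * h < T) by (intros; split; nra).
  assert (Dt : forall (f : R -> R) h c l, derivable_pt_lim f (c * h) l ->
    is_derive (fun c => f (c * h)) c (h * l)).
  { intros f h c l H. apply (is_derive_comp f (fun c => c * h)); [now apply is_derive_Reals|].
    auto_derive; [easy|]. ring. }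
  assert (HT2 : 0 < T / 2) by lra.
  assert (Dq : forall k, eventually_derive (qq k) (pp k)).
  { intros k. apply (near_imp _ _ (near_lt _ HT2)). intros h _ Hh c Hc.
    apply (Dt (fun t => q t k)). apply Hode. now apply HcT. }
  assert (Dp : forall k, eventually_derive (pp k) (fun h c =>
     fsum m (fun l => B (fun i => qq i h c) k l * pp l h c) - gradU (fun i => qq i h c) k)).
  { intros k. apply (near_imp _ _ (near_lt _ HT2)). intros h _ Hh c Hc.
    apply (Dt (fun t => p t k)). apply Hode. now apply HcT. }
  assert (Op : forall k, Ord 0 (pp k)).
  { intros k. assert (D0 : - T < 0 < T) by lra.
    assert (C0 := derivable_continuous_pt _ _ (exist _ _ (proj2 (Hode 0 k D0)))).
    destruct (C0 1 Rlt_0_1) as [d [Hd H]].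
    exists (Rabs (p0 k) + 1). assert (Hp := Rabs_pos (p0 k)). split; [lra|].
    apply (near_imp _ _ (near_lt d Hd)). intros h _ Hh c Hc. simpl. rewrite Rmult_1_r.
    unfold pp. replace (p (c * h) k) with ((p (c * h) k - p0 k) + p0 k) by ring.
    apply Rle_trans with (1 := Rabs_triang _ _).
    (* Continuity in this form speaks only of points different from the limit point, so time 0 is
       treated apart. *)
    destruct (Req_dec (c * h) 0) as [E|E].
    - rewrite E, Hp0, Rminus_diag, Rabs_R0. lra.
    - assert (Rabs (p (c * h) k - p0 k) < 1); [|lra].
      rewrite <- Hp0. apply (H (c * h)). split; [split; [easy|now apply not_eq_sym]|].
      change (Rabs (c * h - 0) < d). rewrite Rminus_0_r, Rabs_pos_eq; nra. }
  assert (Main := method_order m s B gradU q0 p0 uu vv qq pp SB SdU Du Dv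
    ltac:(intros; unfold uu; rewrite Z; ring) ltac:(intros; unfold vv; rewrite Z; ring) Ov Dq Dp
    ltac:(intros; unfold qq; now rewrite Rmult_0_l) ltac:(intros; unfold pp; now rewrite Rmult_0_l) Op).
  destruct (Ord_fin _ _ _ (fun k => proj1 (Main k))) as [K1 [HK1 N1]].
  destruct (Ord_fin _ _ _ (fun k => proj2 (Main k))) as [K2 [HK2 N2]].
  destruct (filter_and _ _ (near_lt h0 Hh0) (filter_and _ _ N1 N2)) as [d Hd].
  exists (K1 + K2), d. split; [apply cond_pos|].
  intros h k Hh.
  destruct (Hd h) as [Hh1 [H1 H2]].
  { change (Rabs (h - 0) < d). rewrite Rminus_0_r, Rabs_pos_eq; lra. }
  { easy. }
  specialize (H1 k 1 ltac:(lra)). specialize (H2 k 1 ltac:(lra)).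
  rewrite <- Eu in H1 by lra. rewrite <- Ev in H2 by lra. unfold qq in H1. unfold pp in H2.
  rewrite Rmult_1_l in H1, H2.
  assert (0 < h ^ (2 * s + 1)) by (apply pow_lt; lra). rewrite Rmult_plus_distr_r.
  assert (0 < K1 * h ^ (2 * s + 1)) by (apply Rmult_lt_0_compat; lra).
  assert (0 < K2 * h ^ (2 * s + 1)) by (apply Rmult_lt_0_compat; lra).
  split; lra.
Qed.
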